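(* Let $F(x,y)$ be an irreducible binary form with integral coefficients, degree $n\geq 3$ and discriminant $D\neq 0$, and let $m$ be a positive integer. Then the number of primitive solutions $(x,y)$ of the inequality $|F(x,y)|\leq m$ with $$y>\left(2^{n/(n-2)}\, n^{\frac{2n-1}{2n-4}}\, m^{\frac{1}{n-2}}\, M(F)\right)^{1+\frac{1}{n-1}}$$ is at most $11n$, and at most $9n$ if $n\geq 5$.
   Context: If $F(x,y)=a_0(x-\alpha_1 y)\cdots(x-\alpha_n y)$ with $a_0\neq 0$, the Mahler measure is $M(F)=|a_0|\prod_{i=1}^n\max(1,|\alpha_i|)$. A pair $(x,y)\in\mathbb{Z}^2$ is a primitive solution if it satisfies the inequality and $\gcd(x,y)=1$; solutions $(x,y)$ and $(-x,-y)$ are regarded as one solution. *)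

(* Defs.v *)
From HB Require Import structures.
From mathcomp Require Import all_boot all_order all_algebra.
(* mpoly must be imported before the analysis libraries: the reverse order
   makes their notation levels clash. *)
From mathcomp Require Import complex mpoly.
From mathcomp Require Import all_classical all_reals exp.

Set Implicit Arguments.
Unset Strict Implicit.
Unset Printing Implicit Defensive.

Import Order.TTheory GRing.Theory Num.Theory.

Local Open Scope ring_scope.

Definition irreducible_elt (A : unitRingType) (a : A) : Prop :=
  a \isn't a GRing.unit /\
  forall b c : A, a = b * c -> b \is a GRing.unit \/ c \is a GRing.unit.

(* Irreducibility of an integral form is taken over the rationals. *)
Definition irreducible_form (F : {mpoly int[2]}) : Prop :=
  irreducible_elt (map_mpoly (intr : int -> rat) F).

Definition form_val (A : comNzRingType) (F : {mpoly int[2]}) (x y : A) : A :=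
  mmap intr (tnth [tuple x; y]) F.

(* If F(1, 0) = a_0 != 0 and F = a_0 (x - alpha_1 y) ... (x - alpha_n y) over
   the complex numbers, this is the list of the alpha_i, with multiplicity. *)
Definition form_roots (R : realType) (F : {mpoly int[2]}) : seq R[i] :=
  sval (closed_field_poly_normal (form_val F ('X : {poly R[i]}) 1)).

Definition form_lead (F : {mpoly int[2]}) : int := form_val F 1 0.

Definition form_disc (R : realType) (n : nat) (F : {mpoly int[2]}) : R[i] :=
  let s := form_roots R F in
  (form_lead F)%:~R ^+ (2 * n - 2) *
  \prod_(j < size s) \prod_(i < j) (s`_i - s`_j) ^+ 2.

Definition mahler (R : realType) (F : {mpoly int[2]}) : R :=
  `|(form_lead F)%:~R| *
  \prod_(a <- form_roots R F) Num.max 1 (ComplexField.Normc.normc a).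

Definition primitive_solution (F : {mpoly int[2]}) (m : nat) (x y : int) :
    Prop :=
  gcdz x y = 1 /\ `|form_val F x y| <= m%:Z.

(* Main.v *)
(** The method is Thue's.  Let [f(x) = F(x, 1)], with roots [alpha_i], and let
    [L] be the logarithm of the base of the power [Y].  A solution [(x, y)] is a
    very good approximation [x / y] of its nearest root (Lewis-Mahler): the
    derivative of [f] at a root is bounded below because the discriminant is a
    nonzero integer while the Vandermonde determinant of the other roots is
    bounded by its Leibniz expansion.  Two approximations of the same root repel
    each other, so that along the solutions attached to one root the quantity
    [ln y - L] grows at each step by a factor at least [n - 1], starting from
    more than [L / (n - 1)].

    On the other hand, the box principle provides [A, B] in [Z[x]] of degree at
    most [d], not both zero and with small coefficients, such that
    [A(x) - alpha_i B(x)] vanishes to order [k] at every [alpha_i].  The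
    Wronskian of [A] and [B] is not zero and is divisible by [f ^ (k - 1)], hence
    for two approximations [t1, t2] of the same root some derivative of small
    order of [A(x) - t2 B(x)] does not vanish at [t1].  Its value there is a
    rational number, hence not too small, but it is close to the value at
    [x = alpha_i] with [t2] replaced by [alpha_i], which is zero.  This is a
    contradiction as soon as the logarithm of the denominator of [t1] is large
    compared with [L] and [d, k] are suited to the ratio of the logarithms of
    the two denominators, which can be achieved when a root has 12 solutions for
    [n = 3], or 10 solutions for [n >= 4]. *)

Require Import Defs.
From HB Require Import structures.
From mathcomp Require Import all_boot all_order all_algebra all_fingroup.
From mathcomp Require Import complex mpoly.
From mathcomp Require Import all_classical all_reals sequences exp.
From mathcomp Require Import ring lra zify.

Set Implicit Arguments.
Unset Strict Implicit.
Unset Printing Implicit Defensive.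

Import Order.TTheory GRing.Theory Num.Theory.

Local Open Scope ring_scope.


(** * Algebraic integers and products of roots *)

Section IntegralElements.
Variable C : numClosedFieldType.

Notation integral := (integralOver (intr : int -> C)).

Definition integral_coefs (p : {poly C}) : Prop := forall i, integral p`_i.

Lemma integral_sum (I : Type) (r : seq I) (P : pred I) (F : I -> C) :
  (forall i, P i -> integral (F i)) -> integral (\sum_(i <- r | P i) F i).
Proof.
move=> h; apply: (big_ind (fun x => integral x)) => //.
- exact: integral0.
- exact: integral_add.
Qed.

Lemma integral_prod (I : Type) (r : seq I) (P : pred I) (F : I -> C) :
  (forall i, P i -> integral (F i)) -> integral (\prod_(i <- r | P i) F i).
Proof.
move=> h; apply: (big_ind (fun x => integral x)) => //.
- exact: integral1.
- exact: integral_mul.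
Qed.

Lemma integral_exp (x : C) k : integral x -> integral (x ^+ k).
Proof.
move=> hx; elim: k => [|k IH]; first exact: integral1.
by rewrite exprS; apply: integral_mul.
Qed.

Lemma integral_signr (x : C) k : integral ((-1) ^+ k * x) -> integral x.
Proof.
move=> h; rewrite -(signrMK k x); apply: integral_mul h.
by apply: integral_exp; apply: integral_opp; apply: integral1.
Qed.

Lemma integral_sqr_root (x : C) : integral (x ^+ 2) -> integral x.
Proof.
move=> h; apply: (@integral_root_monic _ _ _ x ('X^2 - (x ^+ 2)%:P)).
- rewrite monicE lead_coefDl ?lead_coefXn // size_polyXn.
  by rewrite size_polyN size_polyC //; case: eqP.
- by rewrite rootE !hornerE subrr.
- apply/integral_poly => i; rewrite coefB coefXn coefC.
  apply: integral_sub; first exact: integral_nat.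
  by case: ifP => _ //; apply: integral0.
Qed.

(* If [a_N] is the leading coefficient of [p], then [a_N * a] is a root of a
   monic polynomial with coefficients [a_N ^ (N-1-i) a_i]. *)
Lemma integral_lead_root (p : {poly C}) (a : C) :
  integral_coefs p -> root p a -> integral (lead_coef p * a).
Proof.
move=> ip pa.
have [p0|p0] := eqVneq p 0.
  by rewrite p0 lead_coef0 mul0r; apply: integral0.
have [le1|gt1] := leqP (size p) 1.
  move: pa p0; rewrite (size1_polyC le1) rootC => /eqP->.
  by rewrite polyC0 eqxx.
pose N := (size p).-2.
have sp : size p = N.+2 by rewrite /N; lia.
pose l := lead_coef p.
have lE : l = p`_N.+1 by rewrite /l lead_coefE sp.
pose q := 'X^(N.+1) + \poly_(i < N.+1) (l ^+ (N - i) * p`_i).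
have qm : q \is monic.
  rewrite monicE /q lead_coefDl ?lead_coefXn // size_polyXn ltnS.
  exact: size_poly.
apply: (@integral_root_monic _ _ _ _ q) => //; last first.
  apply/integral_poly => i; rewrite /q coefD coefXn coef_poly.
  apply: integral_add; first exact: integral_nat.
  case: ifP => _; last exact: integral0.
  by apply: integral_mul (ip _); apply: integral_exp; apply: ip.
rewrite rootE /q hornerD hornerXn.
rewrite (horner_coef_wide _ (size_poly _ _)).
under eq_bigr => i _ do rewrite coef_poly ltn_ord.
have : p.[a] * l ^+ N = 0 by move/rootP: pa => ->; rewrite mul0r.
rewrite horner_coef sp big_ord_recr /= mulrDl -lE addrC.
move=> E0; apply/eqP; rewrite -[RHS]E0; congr (_ + _).
  by rewrite -/l exprMn exprS; ring.
rewrite mulr_suml; apply: eq_bigr => i _.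
rewrite -/l exprMn; have iN : (i <= N)%N by rewrite -ltnS ltn_ord.
have -> : l ^+ N = l ^+ (N - i) * l ^+ i by rewrite -exprD subnK.
by ring.
Qed.

(** Induction on the size. If [l] is the leading coefficient of [p], then [l] and [l * a] are both
    integral, so removing [l X^e] from [p] keeps the coefficients of the product integral and lowers
    the size. *)
Lemma integral_coefs_XsubC (p : {poly C}) (a : C) :
  integral_coefs (p * ('X - a%:P)) -> integral_coefs p.
Proof.
have [N] := ubnP (size p); elim: N p => // N IH p szp ip.
have [->|p0] := eqVneq p 0; first by move=> i; rewrite coef0; apply: integral0.
pose l := lead_coef p; pose e := (size p).-1.
have lcM : lead_coef (p * ('X - a%:P)) = l.
  by rewrite lead_coef_Mmonic ?monicXsubC.
have il : integral l by rewrite -lcM; apply: ip.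
have ila : integral (l * a).
  rewrite -lcM; apply: integral_lead_root => //.
  by rewrite rootM root_XsubC eqxx orbT.
pose p1 := p - l *: 'X^e.
have sp1 : (size p1 < N)%N.
  have sp : (0 < size p)%N by rewrite size_poly_gt0.
  suff: (size p1 <= e)%N by rewrite /e; lia.
  apply/leq_sizeP => j; rewrite leq_eqVlt => /predU1P[<-|lj].
    by rewrite coefB coefZ coefXn eqxx mulr1 /l lead_coefE subrr.
  rewrite coefB coefZ coefXn gtn_eqF // mulr0 subr0 nth_default //.
  exact: leq_trans (leqSpred _) lj.
have ip1 : integral_coefs p1.
  apply: IH sp1 _ => i; rewrite /p1 mulrBl coefB.
  apply: integral_sub (ip i) _.
  rewrite mulrBr coefB -scalerAl -exprSr coefZ coefXn coefMC coefZ coefXn.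
  rewrite [l * _ * a]mulrAC.
  apply: integral_sub; first by apply: integral_mul il _; apply: integral_nat.
  by apply: integral_mul ila _; apply: integral_nat.
move=> i; rewrite -(subrK (l *: 'X^e) p) coefD coefZ coefXn.
apply: integral_add (ip1 i) _.
by apply: integral_mul il _; apply: integral_nat.
Qed.

(** The factors of [t] are divided out one at a time; the constant coefficient of what is left is
    the claimed product up to sign. *)
Lemma integral_subprod (c : C) (s t : seq C) :
  integral_coefs (c *: \prod_(a <- s ++ t) ('X - a%:P)) ->
  integral (c * \prod_(a <- s) a).
Proof.
elim: t => [|b t IH]; last first.
  rewrite (perm_big (b :: s ++ t)) /=; last by rewrite perm_catC perm_cons perm_catC.
  rewrite big_cons mulrC scalerAl => /integral_coefs_XsubC; exact: IH.
rewrite cats0 => /(_ 0%N); rewrite coefZ -horner_coef0 horner_prod.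
under eq_bigr => a _ do rewrite !hornerE -mulN1r.
rewrite big_split /= big_const_seq iter_mulr_1 mulrCA; exact: integral_signr.
Qed.

(* [c ^ e prod_i s_i ^ (E i)] is the product over [t < e] of the elements
   [c prod_(i | E i > t) s_i], each of which is integral. *)
Lemma integral_monomial (c : C) n (s : n.-tuple C) (e : nat) (E : 'I_n -> nat) :
  integral_coefs (c *: \prod_(a <- s) ('X - a%:P)) ->
  (forall i, (E i <= e)%N) ->
  integral (c ^+ e * \prod_(i < n) tnth s i ^+ E i).
Proof.
move=> ic hE.
have -> : c ^+ e * \prod_(i < n) tnth s i ^+ E i =
   \prod_(t < e) (c * \prod_(i < n | (t < E i)%N) tnth s i).
  rewrite big_split /= prodr_const card_ord; congr (_ * _).
  under [RHS]eq_bigr => t _ do rewrite big_mkcond /=.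
  rewrite exchange_big /=; apply: eq_bigr => i _.
  rewrite -big_mkcond /= prodr_const; congr (_ ^+ _).
  have := hE i; move: (E i) => k lk.
  rewrite -sum1_card (eq_bigl (fun t : 'I_e => (t < k)%N)) //.
  by rewrite (big_ord_narrow lk) sum1_card card_ord.
apply: integral_prod => t _.
pose P := fun i : 'I_n => (t < E i)%N.
rewrite -/(P _) -[X in c * X]/(\prod_(i | P i) tnth s i).
rewrite -[\prod_(i | _) _]big_filter -(big_map (tnth s) xpredT id).
apply: (@integral_subprod _ _
  [seq tnth s i | i <- index_enum 'I_n & ~~ P i]).
rewrite -map_cat (perm_big s) //.
rewrite (perm_trans (perm_map _ (permEl (perm_filterC P _)))) //.
have -> : tval s = map (tnth s) (index_enum 'I_n).
  by rewrite [index_enum _]unlock -enumT -[LHS]map_tnth_enum.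
exact: perm_refl.
Qed.

(** Gauss's lemma: [X - q] is [a] times an integral factor [p1] of a monic integral polynomial. The
    leading coefficient of [p1] is then a unit, so [a] is 1 or -1. *)
Lemma integral_rat_int (q : rat) :
  integral (ratr q) -> exists z : int, q = z%:~R.
Proof.
case=> p pm; rewrite rootE => /eqP pq.
have {pq} : root (map_poly (intr : int -> rat) p) q.
  rewrite -(fmorph_root (@ratr C)) -map_poly_comp rootE.
  rewrite (eq_map_poly (g := intr)) ?pq // => z /=; exact: ratr_int.
rewrite root_factor_theorem => /dvdpP_rat_int[p1 [a a0 E1] [r Er]].
have /(congr1 lead_coef) := Er; rewrite lead_coefM (monicP pm) => l1.
have /(congr1 lead_coef) := E1.
rewrite lead_coefZ lead_coefXsubC lead_coef_map_inj //; last exact: intr_inj.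
move=> l2; have : (lead_coef p1) \is a GRing.unit.
  by apply/unitrPr; exists (lead_coef r); rewrite -l1.
rewrite unfold_in => hl.
have ha : exists z : int, a = z%:~R.
  case/orP: hl => /eqP E; move: l2; rewrite E.
    by rewrite mulr1 => <-; exists 1.
  by rewrite rmorphN1 mulrN1 => /eqP; rewrite eq_sym eqr_oppLR => /eqP->; exists (-1).
case: ha => z az; exists (- (z * p1`_0)).
have /(congr1 (fun p : {poly rat} => p`_0)) := E1.
rewrite coefB coefX coefC /= sub0r coefZ coef_map /= az => /eqP.
by rewrite eqr_oppLR => /eqP->; rewrite rmorphN rmorphM.
Qed.

End IntegralElements.

(** * Norms and the discriminant as rational integers *)

Section NormInt.
Variable C : numClosedFieldType.

Notation integral := (integralOver (intr : int -> C)).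
Notation pQ := (map_poly (ratr : rat -> C)).
Notation pZ := (map_poly (intr : int -> C)).

Lemma ratr_map_int (g : {poly int}) : pQ (map_poly intr g) = pZ g.
Proof.
by rewrite -map_poly_comp; apply: eq_map_poly => z; rewrite /= ratr_int.
Qed.

(** Symmetry of the resultant of two monic polynomials, up to sign. *)
Lemma prod_horner_swap (s t : seq C) :
  exists e : nat,
  \prod_(a <- s) (\prod_(b <- t) ('X - b%:P)).[a] =
  (-1) ^+ e * \prod_(b <- t) (\prod_(a <- s) ('X - a%:P)).[b].
Proof.
exists (size s * size t)%N.
under eq_bigr => a _ do rewrite horner_prod.
under [in RHS]eq_bigr => b _ do rewrite horner_prod.
rewrite exchange_big /= mulnC exprM.
rewrite (_ : (-1) ^+ size t ^+ size s = \prod_(b <- t) \prod_(a <- s) (-1 : C)).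
  rewrite -big_split /=; apply: eq_bigr => b _.
  rewrite -big_split /=; apply: eq_bigr => a _.
  by rewrite !hornerE mulN1r opprB.
under eq_bigr => b _ do rewrite big_const_seq iter_mulr_1 count_predT.
by rewrite big_const_seq iter_mulr_1 count_predT -!exprM mulnC.
Qed.

(* Euclid's algorithm: the value only depends on [g %% f], and exchanging the
   roles of [f] and [g %% f] lowers the degree of [f]. *)
Lemma prod_horner_rat (f g : {poly rat}) (s : seq C) :
  pQ f = \prod_(a <- s) ('X - a%:P) ->
  exists q : rat, \prod_(a <- s) (pQ g).[a] = ratr q.
Proof.
have [N] := ubnP (size f); elim: N f g s => // N IH f g s szf fE.
have fm : f \is monic.
  by rewrite -(map_monic (@ratr C)) fE monic_prod_XsubC.
pose r := g %% f.
have -> : \prod_(a <- s) (pQ g).[a] = \prod_(a <- s) (pQ r).[a].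
  apply: eq_big_seq => a sa.
  rewrite {1}(divp_eq g f) rmorphD rmorphM /= hornerD hornerM fE.
  suff -> : (\prod_(a <- s) ('X - a%:P)).[a] = 0 by rewrite mulr0 add0r.
  by apply/rootP; rewrite root_prod_XsubC.
have szr : (size r < size f)%N by rewrite ltn_modp monic_neq0.
have [r0|r0] := eqVneq r 0.
  rewrite r0 rmorph0; exists ((size s == 0%N)%:R).
  under eq_bigr => a _ do rewrite horner0.
  by case: (s) => [|a s']; rewrite ?big_nil ?big_cons ?mul0r /= ?rmorph1 ?rmorph0.
pose c := lead_coef r.
have c0 : c != 0 by rewrite lead_coef_eq0.
pose r1 := c^-1 *: r.
have r1m : r1 \is monic by rewrite monicE /r1 lead_coefZ mulVf.
have [t tE] := closed_field_poly_normal (pQ r1).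
move: tE; rewrite (monicP _) ?scale1r => [tE|]; last by rewrite map_monic.
have [|q hq] := IH r1 f t _ tE.
  by rewrite size_scale ?invr_eq0 //; apply: leq_trans szr _; rewrite -ltnS.
have rE : r = c *: r1 by rewrite scalerA divff // scale1r.
have [e he] := prod_horner_swap s t.
exists (c ^+ size s * ((-1) ^+ e * q)).
rewrite !rmorphM !rmorphXn rmorphN1 /= -hq fE -he -tE.
rewrite rE map_polyZ /=.
under eq_bigr => a _ do rewrite hornerZ.
by rewrite big_split /= big_const_seq iter_mulr_1 count_predT.
Qed.

(** The product over ordered pairs is the squared Vandermonde determinant up to sign; one more
    squaring removes the sign. *)
Lemma sqr_prod_sub_Vandermonde n (s : n.-tuple C) :
  (\prod_(i < n) \prod_(j < n | j != i) (tnth s i - tnth s j)) ^+ 2 =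
  \det (Vandermonde n (\row_i tnth s i)) ^+ 4.
Proof.
pose T (i j : 'I_n) := tnth s i - tnth s j.
have split2 : \prod_(i < n) \prod_(j < n | j != i) T i j =
   \prod_(i < n) \prod_(j < n | (i < j)%N) T i j *
   \prod_(i < n) \prod_(j < n | (i < j)%N) T j i.
  rewrite [X in _ = _ * X](exchange_big_dep xpredT) //= -big_split /=.
  apply: eq_bigr => i _; rewrite (bigID (fun j : 'I_n => (i < j)%N)) /=.
  congr (_ * _); apply: eq_bigl => j; rewrite -val_eqE /=; lia.
rewrite -/T split2 det_Vandermonde.
have -> : \prod_(i < n) \prod_(j < n | (i < j)%N)
   ((\row_i0 tnth s i0) 0 j - (\row_i0 tnth s i0) 0 i) =
   \prod_(i < n) \prod_(j < n | (i < j)%N) T j i.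
  by apply: eq_bigr => i _; apply: eq_bigr => j _; rewrite !mxE.
set P2 := \prod_i \prod_(j | _) T j i.
set P1 := \prod_i \prod_(j | _) T i j.
have h : P1 ^+ 2 = P2 ^+ 2.
  rewrite -!prodrXl; apply: eq_bigr => i _.
  by rewrite -!prodrXl; apply: eq_bigr => j _; rewrite /T -sqrrN opprB.
by rewrite exprMn h -exprD.
Qed.

Section Roots.
Variables (f : {poly int}) (n : nat) (s : n.-tuple C).
Hypothesis f0 : f != 0.
Hypothesis fE : pZ f = (lead_coef f)%:~R *: \prod_(a <- s) ('X - a%:P).

Let a0 : C := (lead_coef f)%:~R.

Let a0_neq0 : a0 != 0.
Proof. by rewrite intr_eq0 lead_coef_eq0. Qed.

Lemma integral_coefs_int : integral_coefs (a0 *: \prod_(a <- s) ('X - a%:P)).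
Proof. by move=> i; rewrite -fE coef_map; apply: integral_id. Qed.

Lemma norm_rat (g : {poly int}) :
  exists q : rat, \prod_(a <- s) (pZ g).[a] = ratr q.
Proof.
pose fq : {poly rat} := (lead_coef f)%:~R^-1 *: map_poly intr f.
have [|q hq] := @prod_horner_rat fq (map_poly intr g) s.
  rewrite map_polyZ /= ratr_map_int fE scalerA fmorphV /= ratr_int mulVf //.
  exact: scale1r.
by exists q; rewrite -hq ratr_map_int.
Qed.

(** Distributing the product over the coefficients of [g] gives monomials of exponent at most [e] in
    each root, which [a0 ^ e] makes integral. The value is also rational, hence an integer. *)
Lemma norm_int (g : {poly int}) (e : nat) : (size g <= e.+1)%N ->
  exists z : int, a0 ^+ e * \prod_(a <- s) (pZ g).[a] = z%:~R.
Proof.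
move=> sg.
have [q hq] := norm_rat g.
pose q1 : rat := (lead_coef f)%:~R ^+ e * q.
have q1E : a0 ^+ e * \prod_(a <- s) (pZ g).[a] = ratr q1.
  by rewrite rmorphM rmorphXn /= ratr_int hq.
suff /integral_rat_int[z hz] : integral (ratr q1).
  by exists z; rewrite q1E hz ratr_int.
rewrite -q1E big_tnth.
under eq_bigr => i _.
  rewrite (horner_coef_wide _ (n := e.+1)); last first.
    by rewrite (leq_trans (size_poly _ _)).
  over.
rewrite bigA_distr_bigA /= mulr_sumr; apply: integral_sum => h _.
rewrite big_split /= mulrCA; apply: integral_mul.
  by apply: integral_prod => i _; rewrite coef_map; apply: integral_id.
have := @integral_monomial _ a0 _ (in_tuple s) e (fun i => h i).
by apply; [exact: integral_coefs_int | move=> i; rewrite -ltnS ltn_ord].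
Qed.

Lemma norm_ge1 (g : {poly int}) (e : nat) : (size g <= e.+1)%N ->
  (forall a, a \in tval s -> (pZ g).[a] != 0) ->
  1 <= `|a0| ^+ e * \prod_(a <- s) `|(pZ g).[a]|.
Proof.
move=> sg h; have [z hz] := norm_int sg.
rewrite -normrX -normr_prod -normrM hz.
suff z0 : z != 0 by rewrite -intr_norm ler1z -gtz0_ge1 normr_gt0.
rewrite -(intr_eq0 C) -hz mulf_neq0 ?expf_neq0 //.
by rewrite prodf_seq_neq0; apply/allP => a sa; apply/implyP => _; apply: h.
Qed.

Lemma deriv_horner_root (a : C) (r : seq C) : perm_eq s (a :: r) ->
  (pZ f^`()).[a] = a0 * \prod_(b <- r) (a - b).
Proof.
move=> hp; rewrite -deriv_map fE (perm_big _ hp) big_cons derivZ derivM.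
rewrite derivXsubC mul1r hornerZ !hornerE subrr mul0r addr0 horner_prod.
by congr (_ * _); apply: eq_bigr => b _; rewrite !hornerE.
Qed.

Hypothesis s_uniq : uniq s.

Lemma prod_deriv_roots :
  \prod_(a <- s) (pZ f^`()).[a] =
  a0 ^+ n * \prod_(i < n) \prod_(j < n | j != i) (tnth s i - tnth s j).
Proof.
rewrite big_tnth /= -[X in a0 ^+ X](size_tuple s).
rewrite -[size s in LHS]/(size (tval s)).
have -> : a0 ^+ size s = \prod_(i < n) a0 by rewrite prodr_const card_ord size_tuple.
rewrite -big_split -(big_tnth _ _ (tval s) xpredT (fun a => (pZ f^`()).[a])).
rewrite -{1}(map_tnth_enum s) big_map enumT -[X in \prod_(j <- X) _]/(index_enum 'I_n).
apply: eq_bigr => i _.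
rewrite (@deriv_horner_root _ (rem (tnth s i) s)); last first.
  by rewrite perm_to_rem ?mem_tnth.
congr (_ * _); rewrite rem_filter // big_filter.
rewrite -{1}(map_tnth_enum s) big_map enumT; apply: eq_bigl => j /=.
by rewrite (inj_eq (tuple_uniqP _ s_uniq)).
Qed.

(** The quantity [D] below is the discriminant up to sign. It is rational by the norm of the
    derivative, integral because [D ^ 2] is the fourth power of [a0 ^ (n - 1)] times a Vandermonde
    determinant, and nonzero because the roots are distinct. *)
Lemma disc_ge1 :
  1 <= `|a0| ^+ (n.-1 * 2) *
     \prod_(i < n) \prod_(j < n | j != i) `|tnth s i - tnth s j|.
Proof.
have [n0|n0] := posnP n.
  move: s_uniq; subst n => _ ; rewrite big_ord0 mul0n expr0 mulr1; exact: lexx.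
set PP := \prod_(i < n) \prod_(j < n | j != i) (tnth s i - tnth s j).
have -> : \prod_(i < n) \prod_(j < n | j != i) `|tnth s i - tnth s j| = `|PP|.
  by rewrite normr_prod; apply: eq_bigr => i _; rewrite normr_prod.
rewrite -normrX -normrM; set D := _ * PP.
have sf : size f = n.+1.
  have := congr1 size (congr1 polyseq fE).
  rewrite size_map_poly_id0 ?intr_eq0 ?lead_coef_eq0 // => ->.
  by rewrite size_scale // size_prod_XsubC size_tuple.
have [q hq] := norm_rat f^`().
have DE : D = ratr (q * (lead_coef f)%:~R ^+ (n.-1 * 2) / (lead_coef f)%:~R ^+ n).
  rewrite !rmorphM fmorphV !rmorphXn /= ratr_int -hq prod_deriv_roots -/a0 -/PP.
  by rewrite /D; field; rewrite ?expf_neq0 ?a0_neq0.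
have iD : integral D.
  apply: integral_sqr_root; rewrite /D exprMn sqr_prod_sub_Vandermonde.
  rewrite -exprM -mulnA exprM -[(2 * 2)%N]/4%N -exprMn; apply: integral_exp.
  (* After transposition the permutation acts on the exponents; each is at most [n - 1], which the
     power of [a0] matches. *)
  rewrite -det_tr /determinant mulr_sumr; apply: integral_sum => t _.
  rewrite mulrCA; apply: integral_mul.
    by apply: integral_exp; apply: integral_opp; apply: integral1.
  under eq_bigr => i _ do rewrite !mxE.
  apply: integral_monomial; first exact: integral_coefs_int.
  by move=> i; rewrite -ltnS prednK.
move: (iD); rewrite DE => /integral_rat_int[z hz].
suff D0 : D != 0.
  rewrite hz ratr_int -intr_norm ler1z -gtz0_ge1 normr_gt0.
  by rewrite -(intr_eq0 C) -(ratr_int C) -hz -DE.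
rewrite /D mulf_neq0 ?expf_neq0 //; apply/prodf_neq0 => i _.
apply/prodf_neq0 => j ji; rewrite subr_eq0.
by rewrite (inj_eq (tuple_uniqP _ s_uniq)) eq_sym.
Qed.

End Roots.
End NormInt.

(** * The real-valued modulus on [R[i]] *)

Section Normc.
Variable R : rcfType.
Notation C := R[i].
Notation nc := (@ComplexField.Normc.normc R).

Lemma normc_norm (z : C) : `|z| = (nc z)%:C%C.
Proof. by []. Qed.

Lemma normc_ge0 (z : C) : 0 <= nc z.
Proof. by rewrite -lecR -normc_norm normr_ge0. Qed.

Lemma normc_M (z w : C) : nc (z * w) = nc z * nc w.
Proof. exact: ComplexField.Normc.normcM. Qed.

Lemma normc_D (z w : C) : nc (z + w) <= nc z + nc w.
Proof. exact: le_normcD. Qed.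

Lemma normc_N (z : C) : nc (- z) = nc z.
Proof. exact: normcN. Qed.

Lemma normc_B (z w : C) : nc (z - w) <= nc z + nc w.
Proof. by rewrite (le_trans (normc_D _ _)) // normc_N. Qed.

Lemma normc_distC (z w : C) : nc (z - w) = nc (w - z).
Proof. by rewrite -normc_N opprB. Qed.

Lemma normc_1 : nc 1 = 1.
Proof. exact: ComplexField.Normc.normc1. Qed.

Lemma normc_0 : nc 0 = 0.
Proof. exact: ComplexField.Normc.normc0. Qed.

Lemma normc_X (z : C) k : nc (z ^+ k) = nc z ^+ k.
Proof.
by elim: k => [|k IH]; rewrite ?expr0 ?normc_1 // !exprS normc_M IH.
Qed.

Lemma normc_prod (I : Type) (r : seq I) (P : pred I) (F : I -> C) :
  nc (\prod_(i <- r | P i) F i) = \prod_(i <- r | P i) nc (F i).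
Proof. exact: (big_morph _ normc_M normc_1). Qed.

Lemma normc_sum (I : Type) (r : seq I) (P : pred I) (F : I -> C) :
  nc (\sum_(i <- r | P i) F i) <= \sum_(i <- r | P i) nc (F i).
Proof.
elim/big_ind2 : _ => //; first by rewrite normc_0.
by move=> x1 x2 y1 y2 h1 h2; rewrite (le_trans (normc_D _ _)) // lerD.
Qed.

Lemma normc_Mn (z : C) k : nc (z *+ k) = nc z *+ k.
Proof. exact: normcMn. Qed.

Lemma normc_int (z : int) : nc z%:~R = `|z%:~R|.
Proof.
apply: complexI; rewrite -normc_norm.
rewrite -(rmorph_int (real_complex R)) normc_norm /= expr0n addr0.
by rewrite sqrtr_sqr.
Qed.

Lemma normc_Re (z : C) : `|complex.Re z| <= nc z.
Proof.
case: z => x y /=; rewrite -sqrtr_sqr ler_sqrt ?addr_ge0 ?sqr_ge0 //.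
by rewrite lerDl sqr_ge0.
Qed.

Lemma normc_Im (z : C) : `|complex.Im z| <= nc z.
Proof.
case: z => x y /=; rewrite -sqrtr_sqr ler_sqrt ?addr_ge0 ?sqr_ge0 //.
by rewrite lerDr sqr_ge0.
Qed.

Lemma normc_conj (z : C) : nc (conjc z) = nc z.
Proof. by case: z => x y /=; rewrite sqrrN. Qed.

(* [3/2] stands for [sqrt 2]. *)
Lemma normc_le_Re_Im (z : C) (b : R) :
  `|complex.Re z| <= b -> `|complex.Im z| <= b -> nc z <= 3 / 2 * b.
Proof.
case: z => x y /= hx hy.
have b0 : 0 <= b by apply: le_trans hx.
have -> : 3 / 2 * b = Num.sqrt ((3 / 2 * b) ^+ 2).
  by rewrite sqrtr_sqr ger0_norm //; lra.
rewrite ler_sqrt ?sqr_ge0 //.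
have hx2 : x ^+ 2 <= b ^+ 2 by rewrite -(ger0_norm (sqr_ge0 x)) normrX lerXn2r ?nnegrE.
have hy2 : y ^+ 2 <= b ^+ 2 by rewrite -(ger0_norm (sqr_ge0 y)) normrX lerXn2r ?nnegrE.
rewrite exprMn; nra.
Qed.

End Normc.

(** * Derivatives at the roots and the Lewis-Mahler inequality *)

Section LewisMahler.
Variable R : rcfType.
Notation C := R[i].
Notation nc := (@ComplexField.Normc.normc R).
Notation pZ := (map_poly (intr : int -> C)).
Notation mu a := (Num.max 1 (nc a)).

Definition poly_mahler (f : {poly int}) (s : seq C) : R :=
  `|(lead_coef f)%:~R| * \prod_(a <- s) mu a.

Lemma mu_ge1 (a : C) : 1 <= mu a.
Proof. by rewrite le_max lexx. Qed.

Lemma mu_ge0 (a : C) : 0 <= mu a.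
Proof. exact: le_trans ler01 (mu_ge1 a). Qed.

Lemma prod_mu_ge1 (s : seq C) : 1 <= \prod_(a <- s) mu a.
Proof.
elim/big_ind : _ => // [x y hx hy|a _]; last exact: mu_ge1.
by apply: le_trans (ler_peMr _ hy) => //; apply: le_trans hx.
Qed.

(** For a list without repetition this is the modulus of the discriminant of the monic polynomial
    with these roots. Pairs are told apart by value, so that a permutation can bring any root to the
    front. *)
Definition prod_dist (t : seq C) : R :=
  \prod_(x <- t) \prod_(y <- t | y != x) nc (x - y).

Lemma perm_prod_dist (t1 t2 : seq C) :
  perm_eq t1 t2 -> prod_dist t1 = prod_dist t2.
Proof.
move=> h; rewrite /prod_dist (perm_big _ h); apply: eq_bigr => x _.
exact: perm_big.
Qed.

Lemma prod_dist_tnth n (s : n.-tuple C) : uniq s ->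
  prod_dist s = \prod_(i < n) \prod_(j < n | j != i) nc (tnth s i - tnth s j).
Proof.
move=> us; rewrite /prod_dist -{1}(map_tnth_enum s) big_map enumT.
apply: eq_bigr => i _; rewrite -{1}(map_tnth_enum s) big_map enumT.
by apply: eq_bigl => j; rewrite (inj_eq (tuple_uniqP _ us)).
Qed.

Lemma prod_dist_cons (a : C) (r : seq C) : a \notin r ->
  prod_dist (a :: r) = (\prod_(b <- r) nc (a - b)) ^+ 2 * prod_dist r.
Proof.
move=> ar; rewrite /prod_dist big_cons big_cons eqxx /= expr2 -mulrA.
congr (_ * _).
  rewrite big_seq_cond [RHS]big_seq; apply: eq_bigl => b.
  by case: (boolP (b \in r)) => //= br; apply: contraNneq ar => <-.
rewrite -big_split /=; apply: eq_big_seq => b br.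
by rewrite big_cons normc_distC ifT //; apply: contraNneq ar => ->.
Qed.

(** Each of the [n!] terms of the Leibniz expansion has exponent at most [n - 1] in every root. This
    is cruder than Hadamard's inequality. *)
Lemma normc_Vandermonde n (s : n.-tuple C) :
  nc (\det (Vandermonde n (\row_i tnth s i))) <=
  n`!%:R * (\prod_(a <- s) mu a) ^+ n.-1.
Proof.
rewrite -det_tr /determinant (le_trans (normc_sum _ _ _)) //.
apply: (@le_trans _ _ (\sum_(t : 'S_n) (\prod_(a <- s) mu a) ^+ n.-1)).
  apply: ler_sum => t _; rewrite normc_M normc_X normc_N normc_1 expr1n mul1r.
  rewrite normc_prod -prodrXl.
  have -> : \prod_(a <- s) mu a ^+ n.-1 = \prod_(i < n) mu (tnth s i) ^+ n.-1.
    by rewrite -{1}(map_tnth_enum s) big_map enumT.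
  apply: ler_prod => i _; rewrite normc_ge0 !mxE normc_X /=.
  apply: (@le_trans _ _ (mu (tnth s i) ^+ t i)).
    by rewrite lerXn2r ?nnegrE ?normc_ge0 ?mu_ge0 // le_max lexx orbT.
  apply: ler_weXn2l; first exact: mu_ge1.
  by have := ltn_ord (t i); lia.
by rewrite sumr_const card_Sn mulr_natl.
Qed.

Lemma prod_dist_le (t : seq C) : uniq t ->
  prod_dist t <= ((size t)`!%:R * (\prod_(a <- t) mu a) ^+ (size t).-1) ^+ 2.
Proof.
move=> ut; rewrite -[prod_dist t]/(prod_dist (in_tuple t)) (prod_dist_tnth (s := in_tuple t)) //.
have := @sqr_prod_sub_Vandermonde C _ (in_tuple t).
move/(congr1 nc); rewrite !normc_X normc_prod.
under eq_bigr => i _ do rewrite normc_prod.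
set P := \prod_i _; set V := \det _ => h.
have hP : P = nc V ^+ 2.
  apply/eqP; rewrite -(@eqrXn2 _ 2) ?exprn_ge0 ?normc_ge0 //.
    by rewrite h -exprM.
  by apply: prodr_ge0 => i _; apply: prodr_ge0 => j _; apply: normc_ge0.
rewrite hP lerXn2r ?nnegrE ?normc_ge0 //; last exact: normc_Vandermonde.
by rewrite mulr_ge0 ?ler0n ?exprn_ge0 // (le_trans ler01) // prod_mu_ge1.
Qed.

Section Poly.
Variables (f : {poly int}) (n : nat) (s : n.-tuple C).
Hypothesis n2 : (2 <= n)%N.
Hypothesis f0 : f != 0.
Hypothesis fE : pZ f = (lead_coef f)%:~R *: \prod_(a <- s) ('X - a%:P).
Hypothesis us : uniq s.

Let a0 : R := `|(lead_coef f)%:~R|.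
Let M := poly_mahler f s.

Lemma normc_lead_ge1 : 1 <= a0.
Proof.
by rewrite /a0 -intr_norm ler1z -gtz0_ge1 normr_gt0 lead_coef_eq0.
Qed.

Lemma poly_mahler_ge1 : 1 <= M.
Proof.
rewrite /M /poly_mahler; have h1 := normc_lead_ge1; have h2 := prod_mu_ge1 s.
by apply: le_trans h1 _; rewrite ler_peMr ?normr_ge0.
Qed.

Lemma normc_root_le_mahler a : a \in tval s -> mu a <= M.
Proof.
move=> sa; rewrite /M /poly_mahler (perm_big _ (perm_to_rem sa)) big_cons /=.
have h1 := normc_lead_ge1; have h2 := prod_mu_ge1 (rem a s).
have h3 := mu_ge1 a; rewrite -/a0 mulrCA ler_peMr //; first exact: mu_ge0.
by apply: le_trans h1 _; rewrite ler_peMr ?normr_ge0.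
Qed.

Lemma prod_dist_ge1 : 1 <= a0 ^+ (n.-1 * 2) * prod_dist s.
Proof.
have := disc_ge1 f0 fE us.
rewrite normc_norm normc_int -rmorphXn /=.
under eq_bigr => i _ do under eq_bigr => j _ do rewrite normc_norm.
under eq_bigr => i _ do rewrite -rmorph_prod.
by rewrite -rmorph_prod -rmorphM lecR -prod_dist_tnth.
Qed.

(** The discriminant splits as the square of the product of the [a - b], that is of the derivative
    at [a] over [a0], times the discriminant product of the other roots, which [prod_dist_le]
    bounds. Of the [2 (n - 1)] factors [a0], two go to the derivative and the others combine with
    the product [Q] into [a0 * Q <= M]. *)
Lemma normc_deriv_ge a : a \in tval s ->
  1 <= nc (pZ f^`()).[a] * ((n.-1)`!%:R * M ^+ n.-2).
Proof.
move=> sa; have pr := perm_to_rem sa; set r := rem a s in pr *.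
have szr : size r = n.-1 by rewrite size_rem // size_tuple.
have := us; rewrite (perm_uniq pr) /= => /andP[ar ur].
have := prod_dist_ge1; rewrite (perm_prod_dist pr) prod_dist_cons //.
rewrite (deriv_horner_root fE pr) normc_M normc_int -/a0 normc_prod.
set P := \prod_(b <- r) _ => h.
have := prod_dist_le ur; rewrite szr => h2.
have a1 := normc_lead_ge1.
have P0 : 0 <= P by apply: prodr_ge0 => b _; apply: normc_ge0.
have m1 := prod_mu_ge1 r; set Q := \prod_(b <- r) mu b in h2 m1.
have MQ : a0 * Q <= M.
  rewrite /M /poly_mahler (perm_big _ pr) big_cons /= -/Q -/a0.
  apply: ler_wpM2l; first exact: normr_ge0.
  by rewrite ler_peMl ?mu_ge1 // (le_trans ler01).
set z := _ * _; have z0 : 0 <= z.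
  rewrite mulr_ge0 // ?mulr_ge0 ?ler0n ?exprn_ge0 //; first exact: normr_ge0.
  by rewrite (le_trans ler01) // poly_mahler_ge1.
rewrite -(@ler_pXn2r _ 2) ?nnegrE // expr1n; apply: le_trans h _.
have Q0 : 0 <= Q by apply: le_trans m1.
have a00 : 0 <= a0 by apply: normr_ge0.
apply: (@le_trans _ _ ((a0 * P * (n.-1`!%:R * (a0 * Q) ^+ n.-2)) ^+ 2)).
  have -> : (a0 * P * (n.-1`!%:R * (a0 * Q) ^+ n.-2)) ^+ 2 =
     a0 ^+ (n.-1 * 2) * (P ^+ 2 * (n.-1`!%:R * Q ^+ n.-2) ^+ 2).
    have gen (A c : R) (e : nat) : (A * P * (c * (A * Q) ^+ e)) ^+ 2 =
        A ^+ (e.+1 * 2) * (P ^+ 2 * (c * Q ^+ e) ^+ 2).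
      rewrite (exprM A) (exprS A) [(A * Q) ^+ e]exprMn.
      by move: (A ^+ e) (Q ^+ e) => x y; ring.
    by rewrite gen prednK // -subn1 subn_gt0.
  by rewrite !ler_wpM2l ?exprn_ge0.
rewrite lerXn2r ?nnegrE //; first by rewrite !mulr_ge0 ?exprn_ge0 ?mulr_ge0.
rewrite /z ler_wpM2l ?mulr_ge0 // ler_wpM2l // lerXn2r ?nnegrE ?mulr_ge0 //.
by rewrite (le_trans ler01) // prod_mu_ge1.
Qed.

Lemma nearest_root (t : C) :
  exists2 a, a \in tval s & forall b, b \in tval s -> nc (t - a) <= nc (t - b).
Proof.
have i0 : 'I_n by apply: (@Ordinal _ 0); lia.
case: (@Order.TotalTheory.arg_minP _ _ _ i0 xpredT (fun i => nc (t - tnth s i))) => // i _ h.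
exists (tnth s i); first exact: mem_tnth.
by move=> b /tnthP[j ->]; apply: h.
Qed.

(** If [a] is the root nearest to [t], then [|a - b| <= 2 |t - b|] for every other root [b]. Hence
    the derivative at [a] times [|t - a|] is at most [2 ^ (n - 1) |f(t)|], and [normc_deriv_ge]
    applies. *)
Lemma lewis_mahler (t : C) :
  exists2 a, a \in tval s &
    nc (t - a) <= 2 ^+ n.-1 * (n.-1)`!%:R * M ^+ n.-2 * nc (pZ f).[t].
Proof.
have [a sa ha] := nearest_root t; exists a => //.
have pr := perm_to_rem sa; set r := rem a s in pr *.
have szr : size r = n.-1 by rewrite size_rem // size_tuple.
have h1 := normc_deriv_ge sa.
have h2 : nc (pZ f^`()).[a] * nc (t - a) <= 2 ^+ n.-1 * nc (pZ f).[t].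
  rewrite (deriv_horner_root fE pr) fE hornerZ (perm_big _ pr) big_cons.
  rewrite hornerM horner_prod !normc_M normc_int -/a0 !hornerE /=.
  rewrite [X in _ <= X](_ : _ = a0 * (2 ^+ n.-1 *
    nc (\prod_(b <- r) ('X - b%:P).[t])) * nc (t - a)); last by ring.
  rewrite ler_wpM2r ?normc_ge0 // ler_wpM2l ?normr_ge0 // -szr !normc_prod.
  have -> : (2 : R) ^+ size r = \prod_(b <- r) 2.
    by rewrite big_const_seq iter_mulr_1 count_predT.
  rewrite -big_split /= !big_seq; apply: ler_prod => b br; rewrite normc_ge0 /=.
  have sb : b \in tval s by rewrite (perm_mem pr) inE br orbT.
  rewrite !hornerE; have := ha b sb; have := normc_B (t - b) (t - a).
  by rewrite (_ : t - b - (t - a) = a - b); [lra | ring].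
have c0 : 0 <= (n.-1)`!%:R * M ^+ n.-2.
  by rewrite mulr_ge0 ?exprn_ge0 // (le_trans ler01) // poly_mahler_ge1.
apply: (@le_trans _ _ (nc (pZ f^`()).[a] * nc (t - a) * (n.-1`!%:R * M ^+ n.-2))).
  by rewrite mulrAC ler_peMl ?normc_ge0.
apply: le_trans (ler_wpM2r c0 h2) _.
by rewrite le_eqVlt; apply/orP; left; apply/eqP; ring.
Qed.

End Poly.
End LewisMahler.

(** * Box principle and construction of the auxiliary polynomials *)

(** Each interval from [- T i] to [T i] is cut into [Q] cells of length [2 T i / Q]; the right
    endpoint falls into a cell of its own, whence [Q.+1]. *)
Lemma box_principle (R : realType) (V I : finType) (phi : V -> I -> R)
    (T : I -> R) (Q : nat) :
  (forall v i, `|phi v i| <= T i) -> (forall i, 0 < T i) -> (0 < Q)%N ->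
  (Q.+1 ^ #|I| < #|V|)%N ->
  exists v w, v != w /\ forall i, `|phi v i - phi w i| <= 2 * T i / Q%:R.
Proof.
move=> hphi T0 Q0 hcard.
pose x v i := (phi v i + T i) / (2 * T i) * Q%:R.
have x0 v i : 0 <= x v i.
  have := hphi v i; rewrite ler_norml => /andP[h1 _].
  by rewrite mulr_ge0 // divr_ge0 //; have := T0 i; lra.
have xQ v i : x v i <= Q%:R.
  have := hphi v i; rewrite ler_norml => /andP[_ h1].
  by rewrite ler_piMl // ler_pdivrMr; have := T0 i; lra.
pose cell v : {ffun I -> 'I_Q.+1} := [ffun i => inord (Num.truncn (x v i))].
have ninj : ~~ injectiveb cell.
  apply/negP => /injectiveP /leq_card; rewrite card_ffun card_ord; lia.
move: ninj => /injectivePn[v [w vw cvw]].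
exists v, w; split => // i.
have := congr1 (fun c : {ffun I -> 'I_Q.+1} => val (c i)) cvw.
have tQ u : (Num.truncn (x u i) < Q.+1)%N.
  by rewrite ltnS -(ler_nat R) (le_trans _ (xQ u i)) // truncn_le.
rewrite !ffunE /= !inordK // => E.
have itv u : (Num.truncn (x u i))%:R <= x u i < (Num.truncn (x u i))%:R + 1.
  by have := truncn_itv (x0 u i); rewrite -natr1.
have := itv v; have := itv w; rewrite -E; move: (Num.truncn (x v i)) => t.
move=> /andP[a1 a2] /andP[b1 b2].
have Ti := T0 i; have Q0' : (0 : R) < Q%:R by rewrite ltr0n.
have xE u : phi u i = x u i * (2 * T i / Q%:R) - T i.
  by rewrite /x; field; rewrite !gt_eqF.
rewrite !xE (_ : _ - _ - _ = (x v i - x w i) * (2 * T i / Q%:R)); last by ring.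
have c0 : 0 <= 2 * T i / Q%:R by rewrite divr_ge0 //; lra.
rewrite normrM (ger0_norm c0) ler_piMl // ler_norml.
by apply/andP; split; lra.
Qed.

Lemma sum_pow2 (j e : nat) : (\sum_(i < e) 2 ^ (j + i) <= 2 ^ (j + e))%N.
Proof.
elim: e => [|e IH]; first by rewrite big_ord0.
by rewrite big_ord_recr /= addnS expnS mul2n -addnn leq_add2r.
Qed.

Lemma bin_le_pow2 (l j : nat) : ('C(l, j) <= 2 ^ l)%N.
Proof.
elim: l j => [|l IH] [|j] //; first by rewrite bin0 expn_gt0.
by rewrite binS expnS mul2n -addnn leq_add.
Qed.

Section Siegel.
Variable R : realType.
Notation C := R[i].
Notation nc := (@ComplexField.Normc.normc R).
Notation pZ := (map_poly (intr : int -> C)).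
Notation mu a := (Num.max 1 (nc a)).

Lemma size_nderivn (A : nzRingType) (p : {poly A}) (d j : nat) :
  (size p <= d.+1)%N -> (size p^`N(j) <= d.+1 - j)%N.
Proof.
move=> sp; apply/leq_sizeP => i hi; rewrite coef_nderivn nth_default ?mul0rn //.
by rewrite (leq_trans sp) // -leq_subLR.
Qed.

(** Divided derivatives are used throughout: they keep coefficients integral, and their binomial
    factors add up to at most [2 ^ (d + 1)] whatever [j] is. *)
Lemma normc_nderivn (p : {poly C}) (c : R) (d j : nat) (a : C) :
  (size p <= d.+1)%N -> (forall i, nc p`_i <= c) ->
  nc p^`N(j).[a] <= c * 2 ^+ d.+1 * mu a ^+ d.
Proof.
move=> sp hc; have c0 : 0 <= c by apply: le_trans (hc 0%N); apply: normc_ge0.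
have m0 : 0 <= mu a ^+ d by rewrite exprn_ge0 ?mu_ge0.
rewrite (horner_coef_wide _ (size_nderivn j sp)).
apply: le_trans (normc_sum _ _ _) _.
apply: (@le_trans _ _ (\sum_(i < d.+1 - j) c * mu a ^+ d * (2 ^ (j + i))%N%:R)).
  apply: ler_sum => i _; rewrite coef_nderivn normc_M normc_Mn normc_X.
  rewrite -[nc p`_(j + i) *+ _]mulr_natr mulrAC; apply: ler_pM => //.
  - by rewrite mulr_ge0 ?exprn_ge0 ?normc_ge0.
  - apply: ler_pM => //; rewrite ?exprn_ge0 ?normc_ge0 //.
    apply: (@le_trans _ _ (mu a ^+ i)).
      by rewrite lerXn2r ?nnegrE ?normc_ge0 ?mu_ge0 // le_max lexx orbT.
    by apply: ler_weXn2l; [exact: mu_ge1 | have := ltn_ord i; lia].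
  - by rewrite ler_nat bin_le_pow2.
rewrite -mulr_sumr -natr_sum mulrAC ler_wpM2r // ler_wpM2l // -natrX ler_nat.
case: (leqP j d.+1) => jd; first by have := sum_pow2 j (d.+1 - j); rewrite subnKC.
have -> : (d.+1 - j = 0)%N by apply/eqP; rewrite subn_eq0 ltnW.
by rewrite big_ord0.
Qed.

Section Poly.
Variables (f : {poly int}) (n : nat) (s : n.-tuple C).
Hypothesis f0 : f != 0.
Hypothesis fE : pZ f = (lead_coef f)%:~R *: \prod_(a <- s) ('X - a%:P).
Hypothesis f_irr : irreducible_poly (map_poly (intr : int -> rat) f).

Let a0 : R := `|(lead_coef f)%:~R|.
Let M := poly_mahler f s.

Lemma mem_rootsE a : (a \in tval s) = root (pZ f) a.
Proof.
by rewrite fE rootZ ?intr_eq0 ?lead_coef_eq0 // root_prod_XsubC.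
Qed.

(** Up to a scalar, [f] is the minimal polynomial over the rationals of each of its roots. *)
Lemma dvdp_of_root (g : {poly int}) a : a \in tval s -> root (pZ g) a ->
  map_poly (intr : int -> rat) f %| map_poly intr g.
Proof.
rewrite mem_rootsE -!ratr_map_int => fa ga.
set fq := map_poly intr f in fa *; set gq := map_poly intr g in ga *.
have [_ h] := f_irr.
have : size (gcdp fq gq) != 1%N.
  apply/negP; rewrite -[_ == _]/(coprimep fq gq).
  rewrite -(coprimep_map (@ratr C)) => /coprimep_root /(_ fa).
  by rewrite -rootE ga.
move=> /h /(_ (dvdp_gcdl _ _)) /eqp_dvdl <-; exact: dvdp_gcdr.
Qed.

Lemma conj_roots (g : {poly int}) a b : a \in tval s -> b \in tval s ->
  root (pZ g) a -> root (pZ g) b.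
Proof.
move=> sa sb /(dvdp_of_root sa); rewrite -(dvdp_map (@ratr C)) !ratr_map_int.
by move/root_dvdp => /(_ b); rewrite -mem_rootsE sb => /(_ isT).
Qed.

Lemma map_conj_int (g : {poly int}) : map_poly conjc (pZ g) = pZ g.
Proof.
rewrite -map_poly_comp; apply: eq_map_poly => z /=.
by rewrite -(rmorph_int (real_complex R)) /=; congr (_ +i* _)%C; rewrite oppr0.
Qed.

Lemma horner_conj (g : {poly int}) a : (pZ g).[conjc a] = conjc (pZ g).[a].
Proof. by rewrite -[in RHS]horner_map /= map_conj_int. Qed.

Lemma mem_conj a : a \in tval s -> conjc a \in tval s.
Proof.
by rewrite !mem_rootsE !rootE horner_conj => /eqP->; rewrite conjc0.
Qed.

(* The real and imaginary parts at a pair of conjugate roots agree up to sign,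
   so one real number per root controls the values at all roots. *)
Definition real_part_at (g : {poly int}) (a : C) : R :=
  let z := (pZ g).[a] in
  if 0 <= complex.Im a then complex.Re z else complex.Im z.

Lemma real_part_at_le (g : {poly int}) a : `|real_part_at g a| <= nc (pZ g).[a].
Proof. by rewrite /real_part_at; case: ifP => _; rewrite ?normc_Re ?normc_Im. Qed.

Lemma real_part_atB (g h : {poly int}) a :
  real_part_at (g - h) a = real_part_at g a - real_part_at h a.
Proof.
by rewrite /real_part_at rmorphB hornerD hornerN; case: ifP => _; rewrite raddfB.
Qed.

(** For a nonreal [a], the numbers recorded at [a] and at its complex conjugate are, up to sign, the
    real and imaginary parts of one value; for a real [a] the value is real. *)
Lemma normc_real_part_at (g : {poly int}) a (b : R) :
  `|real_part_at g a| <= b -> `|real_part_at g (conjc a)| <= b ->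
  nc (pZ g).[a] <= 3 / 2 * b.
Proof.
rewrite /real_part_at horner_conj; set z := _.[a].
have ri : complex.Im a = 0 -> complex.Im z = 0.
  move=> ia; have aE : conjc a = a by case: (a) ia => x y /= ->; rewrite oppr0.
  have := horner_conj g a; rewrite aE -/z; case: (z) => x y /= [].
  by move=> /eqP; rewrite -addr_eq0 -mulr2n mulrn_eq0 /= => /eqP.
case: (ltrgtP (complex.Im a) 0) => ia h1 h2.
- apply: normc_le_Re_Im => //; move: h2.
  have -> : 0 <= complex.Im (conjc a) by case: (a) ia => x y /=; lra.
  by case: (z).
- apply: normc_le_Re_Im => //; move: h2.
  have -> : (0 <= complex.Im (conjc a)) = false by case: (a) ia => x y /=; lra.
  by case: (z) => x y /=; rewrite normrN.
apply: normc_le_Re_Im => //; rewrite ri //.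
by rewrite normr0; apply: le_trans h1.
Qed.

(** The box principle is applied to pairs of polynomials with coefficients between 0 and [H] and to
    one real number for each order and root. For the difference of two pairs in one box, the norm of
    [g j A B] is an integer of modulus less than 1. So [g j A B] vanishes at some root, and then at
    all of them since they are conjugate over the rationals. *)
Lemma siegel (k d H Q : nat) : (0 < H)%N -> (0 < Q)%N ->
  (Q.+1 ^ (k * n) < H.+1 ^ (2 * d.+1))%N ->
  (3 * 2 ^+ d.+2 * H%:R / Q%:R) ^+ n * M ^+ d.+1 < 1 ->
  exists A B : {poly int},
  [/\ A != 0 \/ B != 0, (size A <= d.+1)%N /\ (size B <= d.+1)%N,
      forall i, `|A`_i| <= H%:Z, forall i, `|B`_i| <= H%:Z &
      forall a j, a \in tval s -> (j < k)%N ->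
        (pZ A^`N(j)).[a] = a * (pZ B^`N(j)).[a]].
Proof.
move=> H0 Q0 hcard hM.
pose V := ({ffun 'I_d.+1 -> 'I_H.+1} * {ffun 'I_d.+1 -> 'I_H.+1})%type.
pose P (v : {ffun 'I_d.+1 -> 'I_H.+1}) : {poly int} :=
  \poly_(l < d.+1) (v (inord l) : nat)%:Z.
pose g j (A B : {poly int}) : {poly int} := A^`N(j) - 'X * B^`N(j).
pose phi (v : V) (ji : 'I_k * 'I_n) : R :=
  real_part_at (g ji.1 (P v.1) (P v.2)) (tnth s ji.2).
(* [A] and [X * B] each contribute at most [H * 2 ^ (d + 1) * mu ^ (d + 1)]. *)
pose T (ji : 'I_k * 'I_n) : R := H%:R * 2 ^+ d.+2 * mu (tnth s ji.2) ^+ d.+1.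
have Pc v i : 0 <= (P v)`_i <= H%:Z.
  by rewrite coef_poly; case: ifP => _ //; have := ltn_ord (v (inord i)); lia.
have sP v : (size (P v) <= d.+1)%N by apply: size_poly.
have gE j A B a : (pZ (g j A B)).[a] = (pZ A^`N(j)).[a] - a * (pZ B^`N(j)).[a].
  by rewrite rmorphB rmorphM /= map_polyX hornerD hornerN hornerM hornerX.
have nP v i : nc (pZ (P v))`_i <= H%:R.
  rewrite coef_map normc_int -intr_norm -[H%:R]/(H%:Z%:~R) ler_int.
  by have /andP[h1 h2] := Pc v i; rewrite ger0_norm.
have nPj v j a : nc (pZ (P v)^`N(j)).[a] <= H%:R * 2 ^+ d.+1 * mu a ^+ d.
  rewrite -nderivn_map; apply: normc_nderivn => //.
  by rewrite (leq_trans (size_poly _ _)).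
have [||//||v [w [vw hvw]]] := @box_principle R V _ phi T Q.
- move=> v ji; apply: le_trans (real_part_at_le _ _) _; rewrite gE.
  set a := tnth s _; apply: le_trans (normc_B _ _) _; rewrite normc_M.
  have h1 := nPj v.1 ji.1 a; have h2 := nPj v.2 ji.1 a.
  set X := _ * _ * _ in h1 h2; have X0 : 0 <= X.
    by apply: le_trans h1; apply: normc_ge0.
  have -> : T ji = 2 * X * mu a by rewrite /T /X !exprS; ring.
  have m1 := mu_ge1 a.
  have : nc a * nc (pZ (P v.2)^`N(ji.1)).[a] <= mu a * X.
    by rewrite ler_pM ?normc_ge0 // le_max lexx orbT.
  by have : X <= mu a * X; [rewrite ler_peMl | lra].
- move=> ji; have m0 := lt_le_trans ltr01 (mu_ge1 (tnth s ji.2)).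
  apply: mulr_gt0; last exact: exprn_gt0.
  by apply: mulr_gt0; rewrite ?ltr0n ?exprn_gt0.
- by rewrite card_prod !card_ord card_prod !card_ffun !card_ord -expnD addnn -mul2n.
pose A := P v.1 - P w.1; pose B := P v.2 - P w.2.
have PcB x y i : `|(P x - P y)`_i| <= H%:Z.
  have /andP[x1 x2] := Pc x i; have /andP[y1 y2] := Pc y i.
  by rewrite coefB ler_norml; apply/andP; split; lra.
exists A, B; split.
- have [A0|] := eqVneq A 0; last by left.
  have [B0|] := eqVneq B 0; last by right.
  have Pinj (x y : {ffun 'I_d.+1 -> 'I_H.+1}) : P x - P y = 0 -> x = y.
    move=> /eqP; rewrite subr_eq0 => /eqP E; apply/ffunP => i.
    have := congr1 (fun p : {poly int} => p`_i) E.
    by rewrite !coef_poly ltn_ord inord_val => -[] /val_inj.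
  case/eqP: vw; move: (Pinj _ _ A0) (Pinj _ _ B0).
  by case: (v) (w) => [v1 v2] [w1 w2] /= -> ->.
- split; apply: leq_trans (size_polyD _ _) _;
  by rewrite size_polyN geq_max !sP.
- by move=> i; apply: PcB.
- by move=> i; apply: PcB.
move=> b j sb jk.
have gB : g j A B = g j (P v.1) (P v.2) - g j (P w.1) (P w.2).
  by rewrite /g /A /B !nderivnB; ring.
(* The factor 3 is the 2 of the box principle times the [3 / 2] for recombining real and imaginary
   parts. *)
have hs a : a \in tval s ->
    nc (pZ (g j A B)).[a] <= 3 * 2 ^+ d.+2 * H%:R / Q%:R * mu a ^+ d.+1.
  move=> sa.
  have key c : c \in tval s ->
      `|real_part_at (g j A B) c| <= 2 * (H%:R * 2 ^+ d.+2 * mu c ^+ d.+1) / Q%:R.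
    move=> /tnthP[i ->]; have := hvw (Ordinal jk, i).
    by rewrite /phi /T /= -real_part_atB -gB.
  have h1 := key _ sa; have := key _ (mem_conj sa); rewrite normc_conj => h2.
  have := normc_real_part_at h1 h2; move/le_trans; apply.
  by rewrite le_eqVlt; apply/orP; left; apply/eqP; field; rewrite pnatr_eq0 -lt0n.
suff /hasP[a sa ga] : has (root (pZ (g j A B))) s.
  have := conj_roots sa sb ga; rewrite rootE gE subr_eq0 => /eqP; exact.
apply: contraT => /hasPn nr.
have sg : (size (g j A B) <= d.+2)%N.
  apply: leq_trans (size_polyD _ _) _; rewrite size_polyN geq_max.
  have szP x y : (size (P x - P y)%R <= d.+1)%N.
    by apply: leq_trans (size_polyD _ _) _; rewrite size_polyN geq_max !sP.
  rewrite (leq_trans (size_nderivn j (szP _ _))) /=; last by lia.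
  rewrite mulrC (leq_trans (size_polyMleq _ _)) // size_polyX.
  by rewrite addn2 /= ltnS (leq_trans (size_nderivn j (szP _ _))) // leq_subr.
have := norm_ge1 f0 fE sg nr; rewrite normc_norm normc_int -rmorphXn /=.
under eq_bigr => c _ do rewrite normc_norm.
rewrite -rmorph_prod -rmorphM -(rmorph1 (real_complex R)) lecR leNgt.
case/negP; apply: le_lt_trans hM.
apply: (@le_trans _ _ (a0 ^+ d.+1 *
  \prod_(a <- s) (3 * 2 ^+ d.+2 * H%:R / Q%:R * mu a ^+ d.+1))).
  rewrite ler_wpM2l ?exprn_ge0 ?normr_ge0 // !big_seq.
  by apply: ler_prod => a sa; rewrite normc_ge0 hs.
rewrite big_split /= big_const_seq iter_mulr_1 count_predT size_tuple.
by rewrite mulrCA prodrXl -exprMn.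
Qed.

End Poly.
End Siegel.

(** * Taylor shifts, Wronskians and nonvanishing *)

Section Wronskian.
Variable C : numFieldType.
Implicit Types (p q A B : {poly C}) (a b h : C).

Lemma coef_comp_XaddC p a j : (p \Po ('X + a%:P))`_j = p^`N(j).[a].
Proof.
have -> : p \Po ('X + a%:P) = \poly_(i < size p) p^`N(i).[a].
  rewrite addrC /comp_poly.
  rewrite -[LHS]/((map_poly polyC p).[a%:P + 'X]).
  rewrite nderiv_taylor; last exact: mulrC.
  rewrite size_map_poly poly_def; apply: eq_bigr => i _.
  by rewrite nderivn_map horner_map /= mul_polyC.
rewrite coef_poly; case: ltnP => // hj.
by rewrite nderivn_poly0 // horner0.
Qed.

Lemma comp_XaddC p a h :
  p \Po ('X + (a + h)%:P) = (p \Po ('X + a%:P)) \Po ('X + h%:P).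
Proof.
rewrite -comp_polyA comp_polyD comp_polyX comp_polyC polyCD.
by congr (_ \Po _); ring.
Qed.

Lemma nderivn_shift p a h j :
  p^`N(j).[a + h] =
  \sum_(i < size p) p^`N(j + i).[a] *+ 'C(j + i, j) * h ^+ i.
Proof.
rewrite -coef_comp_XaddC comp_XaddC coef_comp_XaddC.
set q := p \Po _.
have sq : size q = size p by rewrite size_comp_poly2 // size_XaddC.
rewrite (@horner_coef_wide _ (size p)); last first.
  apply/leq_sizeP => i hi; rewrite coef_nderivn nth_default ?mul0rn // sq.
  by rewrite (leq_trans hi) // leq_addl.
by apply: eq_bigr => i _; rewrite coef_nderivn coef_comp_XaddC.
Qed.

Lemma dvdp_XsubC_exp p a k :
  (forall j, (j < k)%N -> p^`N(j).[a] = 0) -> ('X - a%:P) ^+ k %| p.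
Proof.
move=> hj; have -> : p = (p \Po ('X + a%:P)) \Po ('X + (- a)%:P).
  by rewrite -comp_XaddC subrr addr0 comp_polyXr.
rewrite -(poly_take_drop k (p \Po _)).
have -> : take_poly k (p \Po ('X + a%:P)) = 0.
  apply/polyP => i; rewrite coef_take_poly coef0.
  by case: ifP => // /hj; rewrite coef_comp_XaddC.
by rewrite add0r comp_polyM comp_Xn_poly polyCN dvdp_mulIr.
Qed.

Lemma dvdp_prod_XsubC_exp p (t : seq C) k : uniq t ->
  (forall a, a \in t -> ('X - a%:P) ^+ k %| p) ->
  (\prod_(a <- t) ('X - a%:P)) ^+ k %| p.
Proof.
elim: t => [|a t IH] /=; first by rewrite big_nil expr1n dvd1p.
move=> /andP[na ut] h; rewrite big_cons exprMn Gauss_dvdp.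
  by rewrite h ?mem_head // IH // => b tb; rewrite h // inE tb orbT.
apply/coprimep_expl; apply/coprimep_expr.
by rewrite coprimep_sym coprimep_XsubC root_prod_XsubC.
Qed.

Definition wronskian A B : {poly C} := A * B^`() - A^`() * B.

(** This freedom serves twice: to exploit a zero of [A - c B], and to cancel the top coefficient of
    [A]. *)
Lemma wronskian_shift A B (c : C) :
  wronskian A B = wronskian (A - c *: B) B.
Proof. by rewrite /wronskian derivB derivZ -!mul_polyC; ring. Qed.

Lemma dvdp_wronskian A B a (c : C) k : ('X - a%:P) ^+ k %| A - c *: B ->
  ('X - a%:P) ^+ k.-1 %| wronskian A B.
Proof.
case: k => [|k] h; first by rewrite expr0 dvd1p.
rewrite (wronskian_shift A B c) /wronskian.
case/dvdpP: h => q ->; rewrite derivM deriv_exp derivXsubC mul1r /=.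
rewrite exprS; set X := ('X - a%:P) ^+ k.
apply/dvdpP; exists (q * ('X - a%:P) * B^`() - (q^`() * ('X - a%:P) + q *+ k.+1) * B).
rewrite -mulr_natr -[q *+ _]mulr_natr; ring.
Qed.

(** The degree is at most [2 d - 2], one less than the naive bound: subtracting a multiple of one
    polynomial from the other, or exchanging them, reduces to the case where one of them has degree
    less than [d]. *)
Lemma size_wronskian A B d : (size A <= d.+1)%N -> (size B <= d.+1)%N ->
  (size (wronskian A B) <= (d * 2).-1)%N.
Proof.
have key A1 B1 : (size A1 <= d)%N -> (size B1 <= d.+1)%N ->
    (size (wronskian A1 B1) <= (d * 2).-1)%N.
  move=> sA sB; apply: leq_trans (size_polyD _ _) _; rewrite size_polyN geq_max.
  have der q e : (size q <= e)%N -> (size q^`() <= e.-1)%N.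
    move=> sq; have [->|q0] := eqVneq q 0; first by rewrite deriv0 size_poly0.
    have e0 : (0 < e)%N by apply: leq_trans sq; rewrite size_poly_gt0.
    by rewrite -ltnS prednK // (leq_trans (lt_size_deriv q0)).
  have h1 := der _ _ sA; have /= h2 := der _ _ sB.
  have [->|A10] := eqVneq A1 0; first by rewrite deriv0 !mul0r size_poly0.
  move: (size_poly_gt0 A1); rewrite A10 => gA.
  have d0 : (0 < d)%N by apply: leq_trans gA sA.
  apply/andP; split; apply: leq_trans (size_polyMleq _ _) _.
    by rewrite -!subn1 leq_sub2r // (leq_trans (leq_add sA h2)) //; lia.
  by rewrite -!subn1 leq_sub2r // (leq_trans (leq_add h1 sB)) //; lia.
move=> sA sB; have [sB'|] := leqP (size B) d.
  have -> : wronskian A B = - wronskian B A by rewrite /wronskian; ring.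
  by rewrite size_polyN key.
move=> sB'; have sBd : size B = d.+1 by apply/eqP; rewrite eqn_leq sB.
have b0 : B`_d != 0.
  have : lead_coef B != 0 by rewrite lead_coef_eq0 -size_poly_gt0 sBd.
  by rewrite lead_coefE sBd.
rewrite (wronskian_shift A B (A`_d / B`_d)) key //.
apply/leq_sizeP => i; rewrite leq_eqVlt => /predU1P[<-|hi].
  by rewrite coefB coefZ divfK // subrr.
rewrite coefB coefZ (nth_default _ (leq_trans sA hi)).
by rewrite (nth_default _ (leq_trans sB hi)) mulr0 subrr.
Qed.

Lemma deriv_eq0_size p : p^`() = 0 -> (size p <= 1)%N.
Proof.
move=> h; apply/leq_sizeP => -[//|i] _.
have := congr1 (fun q : {poly C} => q`_i) h; rewrite coef_deriv coef0.
by move/eqP; rewrite mulrn_eq0 => /= /eqP.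
Qed.

(** After division by the gcd, the coprime quotients still have zero Wronskian, so each divides its
    own derivative; by degree that derivative is zero and the quotients are constants. *)
Lemma wronskian_eq0 A B : A != 0 \/ B != 0 -> wronskian A B = 0 ->
  exists g (c c' : C), [/\ A = c *: g, B = c' *: g, g != 0 & c != 0 \/ c' != 0].
Proof.
move=> AB0 W0; pose g := gcdp A B.
have g0 : g != 0 by rewrite /g gcdp_eq0 negb_and; case: AB0 => ->; rewrite ?orbT.
pose A1 := A %/ g; pose B1 := B %/ g.
have AE : A = A1 * g by rewrite divpK // dvdp_gcdl.
have BE : B = B1 * g by rewrite divpK // dvdp_gcdr.
have cop : coprimep A1 B1.
  by apply: coprimep_div_gcd; case: AB0 => ->; rewrite ?orbT.
have W1 : wronskian A1 B1 = 0.
  apply/eqP; have : g ^+ 2 * wronskian A1 B1 = 0.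
    by rewrite -[RHS]W0 AE BE /wronskian !derivM; ring.
  by move/eqP; rewrite mulf_eq0 expf_eq0 /= (negPf g0).
have const (P1 P2 : {poly C}) : coprimep P1 P2 -> P1 * P2^`() = P1^`() * P2 -> P1^`() = 0.
  move=> cp E; have [//|d0] := eqVneq P1^`() 0.
  have : P1 %| P1^`().
    by rewrite -(Gauss_dvdpl _ cp) -E dvdp_mulIl.
  move/dvdp_leq => /(_ d0); have P10 : P1 != 0.
    by apply: contraNneq d0 => ->; rewrite deriv0.
  by rewrite leqNgt lt_size_deriv.
have E1 : A1 * B1^`() = A1^`() * B1 by apply/eqP; rewrite -subr_eq0 -/(wronskian _ _) W1.
have dA := deriv_eq0_size (const _ _ cop E1).
have dB : (size B1 <= 1)%N.
  apply: deriv_eq0_size; apply: (const B1 A1); first by rewrite coprimep_sym.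
  by rewrite mulrC -E1 mulrC.
exists g, A1`_0, B1`_0; split => //.
- by rewrite {1}AE {1}(size1_polyC dA) mul_polyC.
- by rewrite {1}BE {1}(size1_polyC dB) mul_polyC.
have [a0|] := eqVneq A1`_0 0; last by left.
have [b0|] := eqVneq B1`_0 0; last by right.
have A10 : A1 = 0 by rewrite (size1_polyC dA) a0.
have B10 : B1 = 0 by rewrite (size1_polyC dB) b0.
by case: AB0; rewrite ?AE ?BE ?A10 ?B10 mul0r eqxx.
Qed.

Section Vanishing.
Variables (A B : {poly C}) (s : seq C) (n k d : nat).
Hypotheses (us : uniq s) (ss : size s = n).
Hypothesis AB0 : A != 0 \/ B != 0.
Hypotheses (sA : (size A <= d.+1)%N) (sB : (size B <= d.+1)%N).
Hypothesis hdk : (d < n.-1 * k)%N.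
Hypothesis van : forall a j, a \in s -> (j < k)%N ->
  A^`N(j).[a] = a * B^`N(j).[a].

Lemma vanish_dvdp (t c : C) e :
  (forall j, (j < e)%N -> A^`N(j).[t] = c * B^`N(j).[t]) ->
  ('X - t%:P) ^+ e %| A - c *: B.
Proof.
move=> h; apply: dvdp_XsubC_exp => j je.
by rewrite nderivnB nderivnZ hornerD hornerN hornerZ h // subrr.
Qed.

(** Otherwise [A = c g] and [B = c' g], and [(c - a c') g] vanishes to order [k] at each root [a].
    At most one root satisfies [c = a c'], so [g] has at least [(n - 1) k > d] zeros with
    multiplicity. *)
Lemma wronskian_neq0 : wronskian A B != 0.
Proof.
apply/eqP => /(wronskian_eq0 AB0)[g [c [c' [AE BE g0 cc]]]].
pose t := [seq a <- s | c - a * c' != 0].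
have ut : uniq t by rewrite filter_uniq.
have st : (n.-1 <= size t)%N.
  pose bad := [seq a <- s | c - a * c' == 0].
  have : (size bad <= 1)%N.
    rewrite /bad.
    case E : [seq a <- s | _] => [|x [|y l]] //.
    have : uniq [seq a <- s | c - a * c' == 0] by rewrite filter_uniq.
    rewrite E /= inE negb_or => /andP[/andP[xy _] _].
    have hin z : z \in [:: x, y & l] -> c = z * c'.
      by rewrite -E mem_filter subr_eq0 => /andP[/eqP].
    have hx := hin x; have hy := hin y; rewrite !inE !eqxx ?orbT in hx hy.
    have := etrans (esym (hx isT)) (hy isT).
    have c'0 : c' != 0.
      case: cc => // c0; apply: contraNneq c0 => c'0.
      by rewrite (hx isT) c'0 mulr0.
    by move/(mulIf c'0)/eqP; rewrite (negPf xy).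
  have <- : (size bad + size t = n)%N.
    by rewrite -ss !size_filter; exact: count_predC.
  by case: (size bad) => [|[|]] // _; rewrite leq_pred.
have dg : (\prod_(a <- t) ('X - a%:P)) ^+ k %| g.
  apply: dvdp_prod_XsubC_exp => // a; rewrite mem_filter => /andP[ca sa].
  have : ('X - a%:P) ^+ k %| A - a *: B by apply: vanish_dvdp => j; apply: van.
  by rewrite AE BE scalerA -scalerBl dvdpZr.
have := dvdp_leq g0 dg.
have -> : size ((\prod_(a <- t) ('X - a%:P)) ^+ k) = (size t * k).+1.
  rewrite -[LHS]prednK ?size_poly_gt0 ?expf_neq0 ?monic_neq0 ?monic_prod_XsubC //.
  by rewrite size_exp size_prod_XsubC mulnC /= mulnC.
have sg : (size g <= d.+1)%N.
  by case: cc => c0; [rewrite -(size_scale g c0) -AE | rewrite -(size_scale g c0) -BE].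
by rewrite leqNgt (leq_ltn_trans sg) // ltnS (leq_trans hdk) // leq_mul2r st orbT.
Qed.

(* The Wronskian vanishes to order [k - 1] at each root, and its degree bounds
   its order of vanishing elsewhere. *)
Lemma nonvanishing (t1 t2 : C) (J : nat) : t1 \notin s ->
  ((d * 2).-1 <= n * k.-1 + J)%N ->
  exists2 j, (j <= J)%N & A^`N(j).[t1] != t2 * B^`N(j).[t1].
Proof.
move=> nt1 hJ.
have [/existsP[j hj]|/existsPn hn] :=
  boolP [exists j : 'I_J.+1, A^`N(j).[t1] != t2 * B^`N(j).[t1]].
  by exists j => //; rewrite -ltnS.
have d1 : ('X - t1%:P) ^+ J %| wronskian A B.
  apply: (@dvdp_wronskian A B t1 t2 J.+1); apply: vanish_dvdp => j hj.
  by have := hn (Ordinal hj); rewrite negbK => /eqP.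
have d2 : (\prod_(a <- s) ('X - a%:P)) ^+ k.-1 %| wronskian A B.
  apply: dvdp_prod_XsubC_exp => // a sa; apply: (@dvdp_wronskian _ _ _ a).
  by apply: vanish_dvdp => j; apply: van.
have : ('X - t1%:P) ^+ J * (\prod_(a <- s) ('X - a%:P)) ^+ k.-1 %| wronskian A B.
  rewrite Gauss_dvdp ?d1 //; apply/coprimep_expl/coprimep_expr.
  by rewrite coprimep_sym coprimep_XsubC root_prod_XsubC.
move/dvdp_leq => /(_ wronskian_neq0).
rewrite size_Mmonic ?expf_neq0 ?polyXsubC_eq0 ?monic_exp ?monic_prod_XsubC //.
rewrite size_exp_XsubC.
have -> : size ((\prod_(a <- s) ('X - a%:P)) ^+ k.-1) = (n * k.-1).+1.
  rewrite -[LHS]prednK ?size_poly_gt0 ?expf_neq0 ?monic_neq0 ?monic_prod_XsubC //.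
  by rewrite size_exp size_prod_XsubC ss /=.
rewrite leqNgt (leq_ltn_trans (size_wronskian sA sB)) // (leq_ltn_trans hJ) //.
by rewrite addSn addnS /= ltnS addnC.
Qed.

End Vanishing.
End Wronskian.

(** * Thue's inequality for two approximations of the same root *)

Section ThueInequality.
Variable R : realType.
Notation C := R[i].
Notation nc := (@ComplexField.Normc.normc R).
Notation pZ := (map_poly (intr : int -> C)).
Notation mu a := (Num.max 1 (nc a)).

Lemma horner_frac_int (g : {poly int}) (e : nat) (p q : int) :
  (size g <= e.+1)%N -> q != 0 ->
  exists z : int, q%:~R ^+ e * (pZ g).[p%:~R / q%:~R] = z%:~R.
Proof.
move=> sg q0; exists (\sum_(i < e.+1) g`_i * p ^+ i * q ^+ (e - i)).
rewrite (@horner_coef_wide _ e.+1); last by rewrite (leq_trans (size_poly _ _)).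
rewrite mulr_sumr rmorph_sum; apply: eq_bigr => i _.
rewrite !rmorphM !rmorphXn coef_map /=.
have ie : (i <= e)%N by rewrite -ltnS.
have -> : (q%:~R : C) ^+ e = q%:~R ^+ (e - i) * q%:~R ^+ i.
  by rewrite -exprD subnK.
have q0' : (q%:~R : C) != 0 by rewrite intr_eq0.
by rewrite expr_div_n; field; rewrite expf_neq0.
Qed.

Section Poly.
Variables (f : {poly int}) (n : nat) (s : n.-tuple C).
Hypothesis n2 : (2 <= n)%N.
Hypothesis f0 : f != 0.
Hypothesis fE : pZ f = (lead_coef f)%:~R *: \prod_(a <- s) ('X - a%:P).
Hypothesis f_irr : irreducible_poly (map_poly (intr : int -> rat) f).
Hypothesis us : uniq s.

Let M := poly_mahler f s.

(** Otherwise [f], of degree at least 2, would divide [q X - p]. *)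
Lemma frac_notin_roots (p q : int) : q != 0 -> p%:~R / q%:~R \notin tval s.
Proof.
move=> q0; apply/negP => sa.
pose g : {poly int} := q *: 'X - p%:P.
have : root (pZ g) (p%:~R / q%:~R).
  rewrite rootE rmorphB hornerD hornerN /= map_polyZ hornerZ map_polyX hornerX.
  by rewrite map_polyC hornerC /= mulrC divfK ?subrr // intr_eq0.
move/(dvdp_of_root f0 fE f_irr sa) => h.
have sg : size (map_poly (intr : int -> rat) g) = 2%N.
  rewrite size_map_poly_id0 ?intr_eq0 ?lead_coef_eq0 /g; last first.
    rewrite -size_poly_gt0 size_polyDl size_scale // ?size_polyX //.
    by rewrite size_polyN size_polyC; case: eqP.
  rewrite size_polyDl size_scale // ?size_polyX //.
  by rewrite size_polyN size_polyC; case: eqP.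
have := dvdp_leq _ h; rewrite sg -size_poly_gt0 sg => /(_ isT).
rewrite size_map_poly_id0 ?intr_eq0 ?lead_coef_eq0 //.
have : size (pZ f) = n.+1.
  rewrite fE size_scale ?intr_eq0 ?lead_coef_eq0 // size_prod_XsubC.
  by rewrite size_tuple.
by rewrite size_map_poly_id0 ?intr_eq0 ?lead_coef_eq0 // => ->; lia.
Qed.

Variables (A B : {poly int}) (k d H : nat).
Hypothesis AB0 : A != 0 \/ B != 0.
Hypothesis sAB : (size A <= d.+1)%N /\ (size B <= d.+1)%N.
Hypothesis hA : forall i, `|A`_i| <= H%:Z.
Hypothesis hB : forall i, `|B`_i| <= H%:Z.
Hypothesis van : forall a j, a \in tval s -> (j < k)%N ->
  (pZ A^`N(j)).[a] = a * (pZ B^`N(j)).[a].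

Lemma size_pZ (p : {poly int}) : size (pZ p) = size p.
Proof.
have [->|p0] := eqVneq p 0; first by rewrite rmorph0 !size_poly0.
by rewrite size_map_poly_id0 // intr_eq0 lead_coef_eq0.
Qed.

Lemma normc_coef_le (p : {poly int}) i : `|p`_i| <= H%:Z ->
  nc (pZ p)`_i <= H%:R.
Proof.
move=> h; rewrite coef_map normc_int -intr_norm -[H%:R]/(H%:Z%:~R) ler_int.
exact: h.
Qed.

(** Taylor expansion at [a] of [A - a B], with [a] a constant: the terms of total order below [k]
    vanish, leaving at least [k - j] factors [h]. Of the [2 * 4 ^ (d + 1)], [2 ^ (d + 2)] bounds the
    derivatives and [2 ^ (d + 1)] the binomials. *)
Lemma normc_auxiliary_near (a h : C) (j : nat) :
  a \in tval s -> nc h <= 1 ->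
  nc ((pZ A^`N(j)).[a + h] - a * (pZ B^`N(j)).[a + h]) <=
  2 * H%:R * (4 * mu a) ^+ d.+1 * nc h ^+ (k - j).
Proof.
move=> sa h1; pose G := pZ A - a *: pZ B.
have [sA sB] := sAB.
have sG : (size G <= d.+1)%N.
  apply: leq_trans (size_polyD _ _) _; rewrite size_polyN geq_max size_pZ sA /=.
  by apply: leq_trans (size_scale_leq _ _) _; rewrite size_pZ.
have Gj i x : G^`N(i).[x] = (pZ A^`N(i)).[x] - a * (pZ B^`N(i)).[x].
  rewrite nderivnB nderivnZ hornerD hornerN hornerZ.
  by rewrite !nderivn_map.
rewrite -Gj nderivn_shift; apply: le_trans (normc_sum _ _ _) _.
have h0 := normc_ge0 h; have m0 := mu_ge0 a.
pose c : R := H%:R * 2 ^+ d.+2 * mu a ^+ d.+1.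
have c0 : 0 <= c.
  by apply: mulr_ge0; [apply: mulr_ge0 => //; apply: exprn_ge0 | apply: exprn_ge0].
have Gc l : nc G^`N(l).[a] <= c.
  rewrite Gj -!nderivn_map; apply: le_trans (normc_B _ _) _; rewrite normc_M.
  have a1 := @normc_nderivn R (pZ A) H%:R d l a; have a2 := @normc_nderivn R (pZ B) H%:R d l a.
  rewrite !size_pZ in a1 a2.
  have {a1} := a1 sA (fun i => normc_coef_le (hA i)).
  have {a2} := a2 sB (fun i => normc_coef_le (hB i)).
  set X := _ * _ * _ => b2 b1; have X0 : 0 <= X.
    by apply: le_trans b1; apply: normc_ge0.
  have -> : c = 2 * X * mu a by rewrite /c /X !exprS; ring.
  have m1 := mu_ge1 a.
  have : nc a * nc (pZ B)^`N(l).[a] <= mu a * X.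
    by rewrite ler_pM ?normc_ge0 // le_max lexx orbT.
  by have : X <= mu a * X; [rewrite ler_peMl | lra].
apply: (@le_trans _ _ (\sum_(i < d.+1 - j) c * nc h ^+ (k - j) * (2 ^ (j + i))%N%:R)).
  pose F i := nc (G^`N(j + i).[a] *+ 'C(j + i, j) * h ^+ i).
  have F0 i : (size G <= j + i)%N -> F i = 0.
    by move=> hi; rewrite /F nderivn_poly0 // horner0 mul0rn mul0r normc_0.
  (* The sums over [size G] and over [d.+1 - j] terms are compared by padding both with zeros to a
     common length. *)
  have FE N : (size G <= j + N)%N -> \sum_(i < N) F i = \sum_(i < N + size G) F i.
    move=> hN; rewrite big_split_ord /= [X in _ + X]big1 ?addr0 // => i _.
    by rewrite F0 // (leq_trans hN) // leq_add2l leq_addr.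
  have -> : \sum_(i < size G) F i = \sum_(i < d.+1 - j) F i.
    rewrite (FE (d.+1 - j)%N); last first.
      by rewrite (leq_trans sG) // -leq_subLR.
    rewrite addnC big_split_ord /= [X in _ = _ + X]big1 ?addr0 // => i _.
    by rewrite F0 // addnCA leq_addr.
  apply: ler_sum => i _; rewrite /F.
  have [ik|ik] := ltnP (j + i) k.
    rewrite Gj van // subrr mul0rn mul0r normc_0.
    by apply: mulr_ge0; [apply: mulr_ge0 => //; apply: exprn_ge0 | apply: ler0n].
  rewrite normc_M normc_Mn normc_X -[nc G^`N(j + i).[a] *+ _]mulr_natr mulrAC.
  apply: ler_pM => //.
  - by rewrite mulr_ge0 ?exprn_ge0 ?normc_ge0.
  - apply: ler_pM; rewrite ?exprn_ge0 ?normc_ge0 //.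
    by apply: ler_wiXn2l => //; rewrite leq_subLR.
  - by rewrite ler_nat bin_le_pow2.
rewrite -mulr_sumr -natr_sum.
have hs : ((\sum_(i < d.+1 - j) 2 ^ (j + i))%N%:R : R) <= 2 ^+ d.+1.
  rewrite -natrX ler_nat; case: (leqP j d.+1) => jd.
    by have := sum_pow2 j (d.+1 - j); rewrite subnKC.
  have -> : (d.+1 - j = 0)%N by apply/eqP; rewrite subn_eq0 ltnW.
  by rewrite big_ord0.
apply: le_trans (ler_wpM2l _ hs) _; first by apply: mulr_ge0 => //; apply: exprn_ge0.
have -> : c * nc h ^+ (k - j) * 2 ^+ d.+1 = 2 * H%:R * (4 * mu a) ^+ d.+1 * nc h ^+ (k - j).
  have -> : (4 : R) = 2 * 2 by ring.
  by rewrite /c (exprS 2 d.+1) !exprMn; ring.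
exact: lexx.
Qed.

(** For a suitable [j], the value [v] of the derivative of [A - t2 B] at [t1] is nonzero and becomes
    an integer after multiplication by [q1 ^ (d - j) * q2]. The upper bound comes from replacing
    [t2] by [a], at the cost of [(t2 - a)] times the derivative of [B]. *)
Lemma thue_inequality (p1 q1 p2 q2 : int) (J : nat) (a : C) :
  0 < q1 -> 0 < q2 -> (d < n.-1 * k)%N -> ((d * 2).-1 <= n * k.-1 + J)%N ->
  a \in tval s -> nc (p1%:~R / q1%:~R - a) <= 1 ->
  exists2 j, (j <= J)%N &
    1 <= q1%:~R ^+ (d - j) * q2%:~R * (2 * H%:R * (4 * M) ^+ d.+1) *
         (nc (p1%:~R / q1%:~R - a) ^+ (k - j) + nc (p2%:~R / q2%:~R - a)).
Proof.
move=> q1_gt0 q2_gt0 hdk hJ sa r1.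
set t1 := p1%:~R / q1%:~R in r1 *; set t2 := p2%:~R / q2%:~R.
have [sA sB] := sAB.
have q10 : q1 != 0 by rewrite gt_eqF.
have q20 : q2 != 0 by rewrite gt_eqF.
have AB0' : pZ A != 0 \/ pZ B != 0.
  by case: AB0 => h; [left|right]; rewrite -size_poly_gt0 size_pZ size_poly_gt0.
have sA' : (size (pZ A) <= d.+1)%N by rewrite size_pZ.
have sB' : (size (pZ B) <= d.+1)%N by rewrite size_pZ.
have van' b j : b \in tval s -> (j < k)%N -> (pZ A)^`N(j).[b] = b * (pZ B)^`N(j).[b].
  by rewrite !nderivn_map; apply: van.
have [j jJ] := nonvanishing us (size_tuple s) AB0' sA' sB' hdk van' t2
  (frac_notin_roots p1 q10) hJ.
rewrite !nderivn_map -/t1 => hne; exists j => //.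
(* Beyond order [d] both derivatives vanish, so the exponent [d - j] is not truncated. *)
have jd : (j <= d)%N.
  rewrite leqNgt; apply: contra hne => jd.
  by rewrite !nderivn_poly0 ?rmorph0 ?horner0 ?mulr0 // (leq_trans _ jd).
have se : ((d - j).+1 = d.+1 - j)%N by rewrite subSn.
have [|zA hzA] := @horner_frac_int A^`N(j) (d - j) p1 q1 _ q10.
  by rewrite se size_nderivn.
have [|zB hzB] := @horner_frac_int B^`N(j) (d - j) p1 q1 _ q10.
  by rewrite se size_nderivn.
set v := (pZ A^`N(j)).[t1] - t2 * (pZ B^`N(j)).[t1].
have v0 : v != 0 by rewrite subr_eq0.
have hz : q1%:~R ^+ (d - j) * q2%:~R * v = (q2 * zA - p2 * zB)%:~R.
  rewrite rmorphB !rmorphM /= -hzA -hzB -/t1 /v /t2; field.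
  by rewrite intr_eq0.
have low : 1 <= q1%:~R ^+ (d - j) * q2%:~R * nc v.
  have : nc (q1%:~R ^+ (d - j) * q2%:~R * v) = nc (q2 * zA - p2 * zB)%:~R by rewrite hz.
  have absz (q : int) : 0 < q -> `|q%:~R : R| = q%:~R.
    by move=> q_gt0; rewrite gtr0_norm ?ltr0z.
  rewrite !normc_M normc_X !normc_int (absz q1) // (absz q2) // => ->.
  rewrite -intr_norm ler1z -gtz0_ge1 normr_gt0 -(intr_eq0 C) -hz.
  by rewrite !mulf_neq0 ?expf_neq0 ?intr_eq0.
have M1 := poly_mahler_ge1 s f0; have aM := normc_root_le_mahler f0 sa.
rewrite -/M in M1 aM; have M0 : 0 <= M by apply: le_trans M1.
set K := 2 * H%:R * _.
have M4 : 0 <= 4 * M by apply: mulr_ge0.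
have H2 : 0 <= 2 * H%:R :> R by apply: mulr_ge0.
have K0 : 0 <= K by apply: mulr_ge0 => //; apply: exprn_ge0.
apply: le_trans low _; rewrite -[X in _ <= X]mulrA.
have qq0 : 0 <= q1%:~R ^+ (d - j) * q2%:~R :> R.
  by apply: mulr_ge0; [apply: exprn_ge0|]; rewrite ler0z ltW.
apply: ler_wpM2l => //.
have -> : v = ((pZ A^`N(j)).[t1] - a * (pZ B^`N(j)).[t1])
   - (t2 - a) * (pZ B^`N(j)).[t1] by rewrite /v; ring.
apply: le_trans (normc_B _ _) _; rewrite mulrDr; apply: lerD.
  have := @normc_auxiliary_near a (t1 - a) j sa r1; rewrite (addrC a) subrK.
  move/le_trans; apply; apply: ler_wpM2r; first by rewrite exprn_ge0 ?normc_ge0.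
  apply: ler_wpM2l => //; apply: lerXn2r; rewrite ?nnegrE //.
    by apply: mulr_ge0 => //; apply: mu_ge0.
  by rewrite ler_wpM2l.
rewrite normc_M mulrC; apply: ler_wpM2r; first exact: normc_ge0.
have := @normc_nderivn R (pZ B) H%:R d j t1 sB' (fun i => normc_coef_le (hB i)).
rewrite nderivn_map; move/le_trans; apply.
have mt : mu t1 <= 2 * M.
  have : nc t1 <= nc (t1 - a) + nc a.
    by have := normc_D (t1 - a) a; rewrite subrK.
  have m1 := mu_ge1 a; have : nc a <= mu a by rewrite le_max lexx orbT.
  by move=> *; rewrite ge_max; apply/andP; split; lra.
apply: (@le_trans _ _ (H%:R * 2 ^+ d.+1 * (2 * M) ^+ d.+1)).
  apply: ler_wpM2l; first by apply: mulr_ge0 => //; apply: exprn_ge0.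
  apply: (@le_trans _ _ (mu t1 ^+ d.+1)).
    by apply: ler_weXn2l => //; apply: mu_ge1.
  by apply: lerXn2r; rewrite ?nnegrE ?mu_ge0 // mulr_ge0.
rewrite /K; have -> : (4 * M) ^+ d.+1 = 2 ^+ d.+1 * (2 * M) ^+ d.+1.
  by rewrite -exprMn; congr (_ ^+ _); ring.
rewrite mulrA; apply: ler_wpM2r; first by apply: exprn_ge0; apply: mulr_ge0.
by apply: ler_wpM2r; [apply: exprn_ge0 | apply: ler_peMl; rewrite ?ler1n].
Qed.

End Poly.
End ThueInequality.

(** * Size of the auxiliary polynomials in logarithmic form *)

Section ThueWindow.
Variable R : realType.
Notation C := R[i].
Notation nc := (@ComplexField.Normc.normc R).
Notation pZ := (map_poly (intr : int -> C)).

Lemma ln2_gt0 : 0 < ln (2 : R).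
Proof. by rewrite ln_gt0 // ltr1n. Qed.

(** This is [8 < 9]. *)
Lemma ln2_lt_ln3 : 3 * ln (2 : R) < 2 * ln 3.
Proof.
rewrite !mulr_natl -!lnXn ?ltr0n // ltr_ln ?posrE ?exprn_gt0 ?ltr0n //.
by rewrite -!natrX ltr_nat.
Qed.

Section Poly.
Variables (f : {poly int}) (n : nat) (s : n.-tuple C).
Hypothesis n3 : (3 <= n)%N.
Hypothesis f0 : f != 0.
Hypothesis fE : pZ f = (lead_coef f)%:~R *: \prod_(a <- s) ('X - a%:P).
Hypothesis f_irr : irreducible_poly (map_poly (intr : int -> rat) f).
Hypothesis us : uniq s.

Let M := poly_mahler f s.
Let N : R := n%:R.

Variables (L lm : R).
Hypothesis lm0 : 0 <= lm.
Hypothesis hL :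
  (N - 2) * L = N * ln 2 + (N - 2^-1) * ln N + lm + (N - 2) * ln M.

Lemma N_ge3 : 3 <= N.
Proof. by rewrite /N ler_nat. Qed.

Lemma lnM_ge0 : 0 <= ln M.
Proof. by rewrite ln_ge0 // poly_mahler_ge1. Qed.

Lemma lnN_ge : ln 3 <= ln N.
Proof. by have h := N_ge3; rewrite ler_ln ?posrE //; lra. Qed.

Lemma L_ge : ln M + ln 2 + ln 3 <= L.
Proof.
have h3 := N_ge3; have l2 := ln2_gt0; have l3 := lnN_ge; have l23 := ln2_lt_ln3.
have n0 : 0 < N - 2 by lra.
rewrite -(ler_pM2l n0) hL; have := lm0; nra.
Qed.

(** There are [2 (d + 1)] unknown coefficients for [n k] conditions. The count in [siegel] then
    amounts to [(H + 1) ^ e] beating [(2 ^ (d + 4) * rho) ^ (n k)], which the relation [hL] defining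
    [L] turns into the bound on [H]. *)
Lemma siegel_log (k d e : nat) : (2 * d.+1 = n * k + e)%N -> (0 < e)%N ->
  (0 < k)%N -> (3 <= d)%N ->
  exists (H : nat) (A B : {poly int}),
  [/\ (H%:R : R) <= expR (k%:R / e%:R * (d.+1%:R * ((N - 2) * L))),
      A != 0 \/ B != 0, (size A <= d.+1)%N /\ (size B <= d.+1)%N,
      (forall i, `|A`_i| <= H%:Z) /\ (forall i, `|B`_i| <= H%:Z) &
      forall a j, a \in tval s -> (j < k)%N ->
        (pZ A^`N(j)).[a] = a * (pZ B^`N(j)).[a]].
Proof.
move=> hd e0 k0 d3.
have h3 := N_ge3; have l2 := ln2_gt0; have l3 := lnN_ge; have l23 := ln2_lt_ln3.
have lM := lnM_ge0; have hLge := L_ge.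
have M1 : 1 <= M := poly_mahler_ge1 s f0.
have M0 : 0 < M by apply: lt_le_trans M1.
set h := k%:R / e%:R * _.
have NL0 : 0 <= (N - 2) * L by apply: mulr_ge0; lra.
have h0 : 0 <= h by apply: mulr_ge0; [apply: divr_ge0 | apply: mulr_ge0].
pose H := Num.truncn (expR h).
have Hle : (H%:R : R) <= expR h by rewrite truncn_le expR_ge0.
have Hlt : expR h < H%:R + 1 by have /andP[_] := truncn_itv (expR_ge0 h); rewrite -natr1.
have H1 : (0 < H)%N by rewrite truncn_gt0 -expR0 ler_expR.
(* The [n]-th root of [M ^ (d + 1)], so that the norm condition of [siegel] becomes [X / Q < 1]; [Q]
   is the first integer above [X]. *)
pose rho := expR (d.+1%:R * ln M / N).
have rho_ge1 : 1 <= rho.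
  rewrite -expR0 ler_expR; apply: divr_ge0; last by lra.
  exact: mulr_ge0.
pose X : R := 3 * 2 ^+ d.+2 * H%:R * rho.
have X0 : 0 < X.
  rewrite /X mulr_gt0 ?expR_gt0 // mulr_gt0 ?ltr0n //.
  by rewrite mulr_gt0 ?exprn_gt0 ?ltr0n.
pose Q := (Num.truncn X).+1.
have Qle : (Num.truncn X)%:R <= X by rewrite truncn_le ltW.
have XQ : X < Q%:R by have /andP[_] := truncn_itv (ltW X0).
have MN : rho ^+ n = M ^+ d.+1.
  rewrite -expRM_natl -/N -{2}(lnK (x := M)) ?posrE // -expRM_natl.
  by congr expR; field; rewrite /N pnatr_eq0 -lt0n; apply: leq_trans n3.
have [||A [B [AB0 sAB hA hB van]]] := @siegel R f n s f0 fE f_irr k d H Q H1 isT.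
- rewrite -(ltr_nat R) !natrX.
  have Q1 : (Q.+1%:R : R) <= 2 ^+ (d + 4) * (H.+1%:R * rho).
    have t0 : 1 <= 2 ^+ d.+2 :> R by rewrite -natrX ler1n expn_gt0.
    have P1 : 1 <= 2 ^+ d.+2 * rho by apply: mulr_ege1.
    have PZ : 0 <= 2 ^+ d.+2 * rho * H%:R :> R.
      by apply: mulr_ge0 => //; apply: le_trans P1.
    have -> : 2 ^+ (d + 4) * (H.+1%:R * rho) =
        4 * (2 ^+ d.+2 * rho * H%:R) + 4 * (2 ^+ d.+2 * rho).
      by rewrite -natr1 (addnC d) -[(4 + d)%N]/(d.+4) !exprS; ring.
    have XE : X = 3 * (2 ^+ d.+2 * rho * H%:R) by rewrite /X; ring.
    by rewrite -natr1 /Q -natr1; move: Qle; rewrite XE; lra.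
  apply: le_lt_trans (lerXn2r (k * n) _ _ Q1) _; rewrite ?nnegrE //.
    by apply: mulr_ge0; [apply: exprn_ge0 | apply: mulr_ge0 => //; apply: expR_ge0].
  have -> : (2 ^+ (d + 4) * (H.+1%:R * rho)) ^+ (k * n) =
      (2 ^+ (d + 4)) ^+ (n * k) * rho ^+ (n * k) * H.+1%:R ^+ (n * k).
    by rewrite !(mulnC n k) [LHS]exprMn [(_ * rho) ^+ _]exprMn; ring.
  rewrite hd (exprD _ (n * k) e) [X in _ < X]mulrC.
  rewrite ltr_pM2r; last by rewrite exprn_gt0 // ltr0n.
  have -> : rho ^+ (n * k) = expR (k%:R * (d.+1%:R * ln M)).
    by rewrite exprM MN expRM_natl expRM_natl lnK ?posrE.
  have -> : (2 ^+ (d + 4)) ^+ (n * k) = expR (k%:R * (N * ((d + 4)%:R * ln 2))) :> R.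
    by rewrite !expRM_natl lnK ?posrE ?ltr0n // exprM.
  rewrite -expRD.
  apply: (@le_lt_trans _ _ (expR (e%:R * h))); last first.
    by rewrite expRM_natl ltr_pXn2r ?nnegrE ?expR_ge0 // -natr1.
  have -> : e%:R * h = k%:R * (d.+1%:R * ((N - 2) * L)).
    by rewrite /h; field; rewrite pnatr_eq0 -lt0n.
  rewrite ler_expR -mulrDr ler_wpM2l // hL.
  have d4 : (4 : R) <= d.+1%:R by rewrite ler_nat.
  have -> : ((d + 4)%:R : R) = d.+1%:R + 3 by rewrite -natrD addSnnS.
  (* [hL] provides [d + 1] times [N * ln 2] where [d + 4] times is required; the missing three are
     taken from the [ln N] term, thanks to [d >= 3]. *)
  have b1 : 3 * N * ln 2 <= d.+1%:R * ((N - 2^-1) * ln N).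
    have a1 : (N - 2^-1) * ln 2 <= (N - 2^-1) * ln N by apply: ler_wpM2l; lra.
    have a2 : 0 <= (N - 2) * ln 2 by apply: mulr_ge0; lra.
    have q1 : 3 * N * ln 2 <= 4 * ((N - 2^-1) * ln N) by lra.
    apply: le_trans q1 _; apply: ler_wpM2r => //; apply: mulr_ge0; lra.
  have b2 : ln M <= (N - 2) * ln M by apply: ler_peMl; lra.
  have b3 : d.+1%:R * ln M <= d.+1%:R * ((N - 2) * ln M) by apply: ler_wpM2l.
  have b4 : 0 <= d.+1%:R * lm by apply: mulr_ge0.
  move: (d.+1%:R : R) b1 b3 b4 => D *; lra.
- have -> : 3 * 2 ^+ d.+2 * H%:R / Q%:R = X / Q%:R / rho.
    by rewrite /X; field; rewrite !gt_eqF ?ltr0n ?expR_gt0.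
  rewrite exprMn exprVn MN -/M divfK ?expf_neq0 ?gt_eqF //.
  rewrite exprn_ilt1; first by rewrite -lt0n (leq_trans _ n3).
  + by apply: divr_ge0 => //; apply: ltW.
  + by rewrite ltr_pdivrMr ?mul1r ?ltr0n.
by exists H, A, B.
Qed.

End Poly.
End ThueWindow.

(** * Contradiction from two approximations of suitable sizes *)

Section ThueContradiction.
Variable R : realType.
Notation C := R[i].
Notation nc := (@ComplexField.Normc.normc R).
Notation pZ := (map_poly (intr : int -> C)).
Variables (f : {poly int}) (n : nat) (s : n.-tuple C).
Hypothesis n3 : (3 <= n)%N.
Hypothesis f0 : f != 0.
Hypothesis fE : pZ f = (lead_coef f)%:~R *: \prod_(a <- s) ('X - a%:P).
Hypothesis f_irr : irreducible_poly (map_poly (intr : int -> rat) f).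
Hypothesis us : uniq s.

Let M := poly_mahler f s.
Let N : R := n%:R.

Variables (L lm : R).
Hypothesis lm0 : 0 <= lm.
Hypothesis hL :
  (N - 2) * L = N * ln 2 + (N - 2^-1) * ln N + lm + (N - 2) * ln M.

(* [d] is the degree of the auxiliary polynomials, [k] their order of vanishing,
   [e] the number of free parameters and [J] the largest order of derivative
   needed for the nonvanishing. *)
Lemma thue_contradiction (p1 q1 p2 q2 : int) (a : C) (k d e J : nat) (u v c : R) :
  0 < q1 -> 0 < q2 -> a \in tval s ->
  u = ln q1%:~R -> v = ln q2%:~R ->
  nc (p1%:~R / q1%:~R - a) <= expR ((N - 2) * L - ln 2 - N * u) ->
  nc (p2%:~R / q2%:~R - a) <= expR ((N - 2) * L - ln 2 - N * v) ->
  L <= u ->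
  (2 * d.+1 = n * k + e)%N -> (J + 3 = e + n)%N -> (0 < e)%N -> (0 < k)%N ->
  (J <= k)%N -> (3 <= d)%N -> (d < n.-1 * k)%N ->
  c = (k%:R / e%:R * (N - 2) + 1) * (d.+1%:R * L) ->
  v + c + (d%:R - J%:R) * u <= (k%:R - J%:R) * (N * u - (N - 2) * L) ->
  c + d%:R * u + (N - 2) * L <= (N - 1) * v ->
  False.
Proof.
move=> q1_gt0 q2_gt0 sa uE vE hr1 hr2 Lu hd hJe e0 k0 Jk d3 hdk cE hI hII.
have h3 : 3 <= N := N_ge3 R n3.
have l2 := @ln2_gt0 R; have l23 := @ln2_lt_ln3 R.
have lM : 0 <= ln M := lnM_ge0 s f0.
have hLge : ln M + ln 2 + ln 3 <= L := L_ge n3 lm0 hL.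
have M1 : 1 <= M := poly_mahler_ge1 s f0.
have M0 : 0 < M by apply: lt_le_trans M1.
have kd : (k <= d)%N.
  have : (3 * k <= n * k)%N by rewrite leq_mul2r n3 orbT.
  by move: hd e0 k0; clear; move: (n * k)%N => x; lia.
(* In fact an equality: [2 d - 1 = n k + e - 3] and [J = e + n - 3]. *)
have hJ : ((d * 2).-1 <= n * k.-1 + J)%N.
  have : (n * k = n * k.-1 + n)%N by rewrite -{1}(prednK k0) mulnS addnC.
  by move: hd hJe n3; clear; move: (n * k)%N (n * k.-1)%N => x y; lia.
have [H [A [B [hH AB0 sAB [hA hB] van]]]] := siegel_log n3 f0 fE f_irr lm0 hL hd e0 k0 d3.
set h := k%:R / e%:R * _ in hH.
have cE' : c = h + d.+1%:R * L by rewrite cE /h; ring.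
have NLu : (N - 2) * L <= (N - 2) * u by apply: ler_wpM2l => //; lra.
have L0 : 0 <= L by lra.
have r1 : nc (p1%:~R / q1%:~R - a) <= 1.
  by apply: le_trans hr1 _; rewrite -[X in _ <= X]expR0 ler_expR; lra.
have [j jJ] := thue_inequality (ltnW n3) f0 fE f_irr us AB0 sAB hA hB van p2
  q1_gt0 q2_gt0 hdk hJ sa r1.
rewrite -/M leNgt => /negP; apply.
have jk : (j <= k)%N by apply: leq_trans Jk.
have jd : (j <= d)%N by apply: leq_trans kd.
have expln (x : R) : 0 < x -> expR (ln x) = x by move=> x0; apply: lnK.
have eu : q1%:~R = expR u by rewrite uE expln // ltr0z.
have ev : q2%:~R = expR v by rewrite vE expln // ltr0z.
pose X := (d%:R - j%:R) * u + v + (ln 2 + h + d.+1%:R * (2 * ln 2 + ln M)).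
have hX : q1%:~R ^+ (d - j) * q2%:~R * (2 * H%:R * (4 * M) ^+ d.+1) <= expR X.
  rewrite /X !expRD -(natrB _ jd) expRM_natl eu ev expRM_natl.
  rewrite (mulr_natl (ln 2)) -lnXn // !expRD !expln ?exprn_gt0 //.
  rewrite -natrX; apply: ler_wpM2l; first by apply: mulr_ge0; rewrite ?exprn_ge0 ?expR_ge0.
  apply: ler_wpM2r; first by apply: exprn_ge0; apply: mulr_ge0 => //; apply: ltW.
  by apply: ler_wpM2l.
have D4 : 4 <= d.+1%:R :> R by rewrite ler_nat.
have b1 : d.+1%:R * (ln M + ln 2 + ln 3) <= d.+1%:R * L by apply: ler_wpM2l.
have l32 : 0 <= ln 3 - ln 2 :> R by lra.
(* As [8 < 9], this makes [(d + 1) (ln 3 - ln 2)] exceed [2 ln 2], which pays for the factor 2 in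
   the constant and for the target [1 / 2]. *)
have b2 := ler_wpM2r l32 D4.
have jJ' : j%:R <= J%:R :> R by rewrite ler_nat.
have jk' : j%:R <= k%:R :> R by rewrite ler_nat.
have j0 : 0 <= j%:R :> R by [].
have X0 := expR_ge0 X.
(* Each of the two terms is below [1 / 2]. This exponent increases with [j], so the worst case is
   [j = J], which [hI] covers; for the second term it is [j = 0], covered by [hII]. *)
have t1 : q1%:~R ^+ (d - j) * q2%:~R * (2 * H%:R * (4 * M) ^+ d.+1) *
    nc (p1%:~R / q1%:~R - a) ^+ (k - j) < 2^-1.
  apply: (@le_lt_trans _ _ (expR (X + (k%:R - j%:R) * ((N - 2) * L - ln 2 - N * u)))).
    rewrite expRD -(natrB _ jk) expRM_natl; apply: ler_pM => //.
    - apply: mulr_ge0; first by apply: mulr_ge0; rewrite ?exprn_ge0 // ler0z ltW.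
      by apply: mulr_ge0; [apply: mulr_ge0|apply: exprn_ge0; apply: mulr_ge0 => //; apply: ltW].
    - by apply: exprn_ge0; apply: normc_ge0.
    - by apply: lerXn2r; rewrite ?nnegrE ?normc_ge0 ?expR_ge0.
  rewrite -[X in _ < X](expln 2^-1) ?invr_gt0 // ltr_expR lnV ?posrE // /X.
  have b3 : (0 : R) <= (k%:R - j%:R) * ln 2 by apply: mulr_ge0; lra.
  have b4 : (0 : R) <= (J%:R - j%:R) * ((N - 1) * u - (N - 2) * L) by apply: mulr_ge0; lra.
  lra.
have t2 : q1%:~R ^+ (d - j) * q2%:~R * (2 * H%:R * (4 * M) ^+ d.+1) *
    nc (p2%:~R / q2%:~R - a) < 2^-1.
  apply: (@le_lt_trans _ _ (expR (X + ((N - 2) * L - ln 2 - N * v)))).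
    rewrite expRD; apply: ler_pM => //.
    - apply: mulr_ge0; first by apply: mulr_ge0; rewrite ?exprn_ge0 // ler0z ltW.
      by apply: mulr_ge0; [apply: mulr_ge0|apply: exprn_ge0; apply: mulr_ge0 => //; apply: ltW].
    - exact: normc_ge0.
  rewrite -[X in _ < X](expln 2^-1) ?invr_gt0 // ltr_expR lnV ?posrE // /X.
  have b3 : (0 : R) <= j%:R * u by apply: mulr_ge0; lra.
  lra.
rewrite mulrDr; lra.
Qed.

End ThueContradiction.

(** * Choice of the parameters from the two logarithms *)

(** With [P] the lower end of a window, this selects the parameter: failure at [l.+1] bounds [v]
    from above. *)
Lemma last_true (P : pred nat) (i j : nat) : (i <= j)%N -> P i -> ~~ P j ->
  exists2 l, (i <= l < j)%N & P l && ~~ P l.+1.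
Proof.
elim: j => [|j IH] ij Pi Pj.
  by move: ij Pi Pj; rewrite leqn0 => /eqP-> ->.
have [Pj'|Pj'] := boolP (P j).
  exists j; last by rewrite Pj'.
  rewrite ltnSn andbT leqNgt; apply: contra Pj => ji.
  by have -> : j.+1 = i by apply/eqP; rewrite eqn_leq ji.
have ij' : (i <= j)%N.
  by rewrite -ltnS ltn_neqAle ij andbT; apply: contraNneq Pj => <-.
by have [l /andP[il lj] hl] := IH ij' Pi Pj'; exists l => //; rewrite il ltnW.
Qed.

Section Windows.
Variable R : realType.
Implicit Types u v L : R.

(* The hypotheses of the final contradiction on the size of two approximations:
   [u] and [v] are the logarithms of their denominators. *)
Definition window (n : nat) u v L : Prop :=
  exists (k d e J : nat) (c : R),
  [/\ (2 * d.+1 = n * k + e)%N, (J + 3 = e + n)%N, (0 < e)%N, (0 < k)%N &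
      [/\ (J <= k)%N, (3 <= d)%N & (d < n.-1 * k)%N] /\
      [/\ c = (k%:R / e%:R * (n%:R - 2) + 1) * (d.+1%:R * L),
          v + c + (d%:R - J%:R) * u <=
            (k%:R - J%:R) * (n%:R * u - (n%:R - 2) * L) &
          c + d%:R * u + (n%:R - 2) * L <= (n%:R - 1) * v]].

(** One free parameter, [e = 1]. Up to multiples of [L], the ratio [v / u] may range from
    [(3 i + 1) / 2] to [3 i], but the cost [c] is quadratic in [i]. *)
Lemma window_small (i : nat) u v L : (1 <= i)%N ->
  v <= 3 * i%:R * u - (6 * i%:R ^+ 2 + 12 * i%:R + 4) * L ->
  (3 * i%:R + 1) * u + (6 * i%:R ^+ 2 + 10 * i%:R + 5) * L <= 2 * v ->
  window 3 u v L.
Proof.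
move=> i1 hI hII.
exists (2 * i + 1)%N, (3 * i + 1)%N, 1%N, 1%N, ((2 * i%:R + 2) * (3 * i%:R + 2) * L).
have kE : ((2 * i + 1)%:R : R) = 2 * i%:R + 1 by rewrite natrD natrM.
have dE : ((3 * i + 1)%:R : R) = 3 * i%:R + 1 by rewrite natrD natrM.
have dE' : ((3 * i + 1).+1%:R : R) = 3 * i%:R + 2 by rewrite -natr1 dE; ring.
split; [lia|lia|lia|lia|split; first by split; lia].
rewrite dE' dE kE.
by split; [field | lra | lra].
Qed.

(** Keeping [k / e = 8] makes the cost [c] linear in [t], so that a fixed lower bound on [u / L]
    serves for arbitrarily large [v / u]. *)
Lemma window_large (n t : nat) u v L (N := n%:R : R) (T := t%:R : R) :
  (3 <= n)%N -> (1 <= t)%N -> (n <= 14 * t + 3)%N ->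
  v <= ((6 * N + 1) * T - (N - 1) * (N - 3) + 1) * u -
       ((8 * N - 15) * (8 * N + 1) * T + (14 * T - N + 3) * (N - 2)) * L ->
  (8 * N - 15) * (8 * N + 1) * T * L + ((8 * N + 1) * T - 1) * u + (N - 2) * L
    <= (N - 1) * v ->
  window n u v L.
Proof.
move=> n3 t1 nt hI hII.
exists (16 * t)%N, ((8 * n + 1) * t).-1, (2 * t)%N, (2 * t + n - 3)%N.
exists ((8 * N - 15) * (8 * N + 1) * T * L).
have D0 : (25 <= (8 * n + 1) * t)%N by nia.
have dS : (((8 * n + 1) * t).-1.+1 = (8 * n + 1) * t)%N by rewrite prednK //; lia.
have dE' : ((((8 * n + 1) * t).-1.+1)%:R : R) = (8 * N + 1) * T.
  by rewrite dS natrM natrD natrM.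
have dE : (((8 * n + 1) * t).-1%:R : R) = (8 * N + 1) * T - 1.
  by apply: (addIr 1); rewrite natr1 dE' subrK.
have JE : ((2 * t + n - 3)%:R : R) = 2 * T + N - 3.
  have J3 : (3 <= 2 * t + n)%N by apply: leq_trans n3 (leq_addl _ _).
  by rewrite (natrB _ J3) natrD natrM.
have T0 : T != 0 by rewrite pnatr_eq0 -lt0n.
split; [rewrite dS; nia|lia|lia|lia|split].
  by split; [lia | lia | nia].
rewrite dE' dE JE !natrM -/N -/T; split; [by field | lra | lra].
Qed.

Lemma window_n3 u v L : 0 < L -> 257 * L <= u -> 4 * (u - L) <= v - L ->
  window 3 u v L.
Proof.
move=> L0 uL vu.
pose P (i : nat) := (3 * i%:R + 1) * u + (6 * i%:R ^+ 2 + 10 * i%:R + 5) * L <= 2 * v.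
have P2 : P 2%N by rewrite /P; lra.
(* For [i] from 2 to 38, [257 * L <= u] makes consecutive windows of [window_small] overlap. Beyond
   that, [window_large] takes over from [t = 3]. *)
have [P39|P39] := boolP (P 39%N); last first.
  have [i /andP[i2 i39] /andP[Pi]] := last_true (isT : (2 <= 39)%N) P2 P39.
  rewrite /P -ltNge -[i.+1%:R]natr1 => PS.
  apply: (@window_small i); [exact: ltnW | | exact: Pi].
  have I2 : 2 <= i%:R :> R by rewrite ler_nat.
  have I38 : i%:R <= 38 :> R by rewrite ler_nat.
  move: (i%:R : R) I2 I38 PS => I I2 I38 PS.
  have q : 0 <= (I - 2) * (38 - I) by apply: mulr_ge0; lra.
  have qL : 0 <= ((I - 2) * (38 - I)) * L by apply: mulr_ge0 => //; lra.
  have IL : 2 * L <= I * L by apply: ler_wpM2r => //; lra.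
  have IL' : I * L <= 38 * L by apply: ler_wpM2r => //; lra.
  have uI : (3/2 * I - 2) * (257 * L) <= (3/2 * I - 2) * u by apply: ler_wpM2l => //; lra.
  lra.
pose Q (t : nat) := (8 * 3 - 15) * (8 * 3 + 1) * t%:R * L + ((8 * 3 + 1) * t%:R - 1) * u + (3 - 2) * L
    <= (3 - 1) * v.
have Q3 : Q 3%N by move: P39; rewrite /P /Q; lra.
have u0 : 0 < u by lra.
have v0 : 0 < v by lra.
have vu0 : 0 <= v / u by apply: divr_ge0; lra.
(* Once [t] exceeds [v / u], the lower end of the window lies above [v]. *)
have NQ : ~~ Q ((Num.truncn (v / u)).+1 + 3)%N.
  have := truncn_itv vu0 => /andP[_]; rewrite ltr_pdivrMr // => h.
  rewrite /Q -ltNge natrD; move: (_.+1%:R : R) h (ler0n R (Num.truncn (v / u)).+1) => x h x0.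
  by have : 0 <= x * L; [apply: mulr_ge0 => //; lra | lra].
have [t /andP[t3 _] /andP[Qt]] := last_true (leq_addl _ _) Q3 NQ.
rewrite /Q -ltNge -[t.+1%:R]natr1 => QS.
have t1 : (1 <= t)%N by apply: leq_trans t3.
have nt : (3 <= 14 * t + 3)%N by rewrite leq_addl.
apply: (window_large (leqnn 3) t1 nt); last exact: Qt.
have T3 : 3 <= t%:R :> R by rewrite ler_nat.
move: (t%:R : R) T3 QS => T T3 QS.
have uT : (13/2 * T - 11) * (257 * L) <= (13/2 * T - 11) * u by apply: ler_wpM2l => //; lra.
have LT : 3 * L <= T * L by apply: ler_wpM2r => //; lra.
lra.
Qed.

(* The upper end of the window for [T] exceeds the lower end for [T + 1]. *)
Lemma window_step (x T u L : R) (c := (8 * x - 7) * (8 * x + 9)) :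
  3 <= x -> x - 1 <= T -> 0 < L -> x ^+ 5 * L <= u ->
  c * (T + 1) * L + ((8 * x + 9) * (T + 1) - 1) * u + (x - 1) * L <=
  x * (((6 * (x + 1) + 1) * T - (x + 1 - 1) * (x + 1 - 3) + 1) * u -
       ((8 * (x + 1) - 15) * (8 * (x + 1) + 1) * T +
        (14 * T - (x + 1) + 3) * (x + 1 - 2)) * L).
Proof.
move=> x3 Tx L0 x5L.
have x2 : 9 <= x ^+ 2 by rewrite expr2; nra.
have x2x : 3 * x <= x ^+ 2 by rewrite expr2; apply: ler_wpM2r; lra.
have x3x : 3 * x ^+ 2 <= x ^+ 3 by rewrite [x ^+ 3]exprS; apply: ler_wpM2r; lra.
have x4x : 3 * x ^+ 3 <= x ^+ 4 by rewrite [x ^+ 4]exprS; apply: ler_wpM2r; lra.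
have u0 : 0 <= u by apply: le_trans x5L; apply: mulr_ge0; [apply: exprn_ge0|]; lra.
have c_le : c <= 70 * x ^+ 2.
  have -> : c = 64 * x ^+ 2 + 16 * x - 63 by rewrite /c; ring.
  by lra.
have T2 : 2 <= T by lra.
have -> : (8 * (x + 1) - 15) * (8 * (x + 1) + 1) = c by rewrite /c; ring.
pose U := T * (6 * x ^+ 2 - x - 9) - x ^+ 3 + 2 * x ^+ 2 - 7 * x - 8.
pose W := c * (T + 1) + (x - 1) + x * (c * T) + x * ((14 * T - x + 2) * (x - 1)).
suff h : W * L <= U * u by rewrite /W /U in h; lra.
have TX : 0 <= T * x ^+ 2 by apply: mulr_ge0; lra.
have U_ge : 2 * x ^+ 2 * T <= U.
  have d1 : (x - 1) * x ^+ 2 <= T * x ^+ 2 by apply: ler_wpM2r; lra.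
  have d2 : 2 * (3 * x ^+ 2 - x - 9) <= T * (3 * x ^+ 2 - x - 9).
    by apply: ler_wpM2r; lra.
  have e1 : (x - 1) * x ^+ 2 = x ^+ 3 - x ^+ 2 by ring.
  by rewrite /U; lra.
have W_le : W <= 110 * x ^+ 3 * T.
  have d1 : c * (T + 1) <= 70 * x ^+ 2 * (T + 1) by apply: ler_wpM2r; lra.
  have d2 : x * (c * T) <= 70 * x ^+ 3 * T.
    have : x * T * c <= x * T * (70 * x ^+ 2).
      by apply: ler_wpM2l => //; apply: mulr_ge0; lra.
    have -> : x * T * (70 * x ^+ 2) = 70 * x ^+ 3 * T by ring.
    by have -> : x * T * c = x * (c * T) by ring.
  have d3 : x * ((14 * T - x + 2) * (x - 1)) <= 14 * x ^+ 2 * T.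
    have -> : 14 * x ^+ 2 * T = x * ((14 * T) * x) by ring.
    apply: ler_wpM2l; first by lra.
    by apply: ler_pM; lra.
  have d4 : 2 * x ^+ 2 <= T * x ^+ 2 by apply: ler_wpM2r; lra.
  have d5 : T * (3 * x ^+ 2) <= T * x ^+ 3 by apply: ler_wpM2l; lra.
  by rewrite /W; lra.
apply: (@le_trans _ _ (110 * x ^+ 3 * T * L)); first by apply: ler_wpM2r; lra.
apply: (@le_trans _ _ (2 * x ^+ 2 * T * u)); last by apply: ler_wpM2r; lra.
have -> : 110 * x ^+ 3 * T * L = 2 * x ^+ 2 * T * (55 * x * L) by ring.
apply: ler_wpM2l; first by apply: mulr_ge0; lra.
apply: le_trans x5L; apply: ler_wpM2r; first by lra.
have -> : x ^+ 5 = x * x ^+ 4 by rewrite exprS.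
by rewrite mulrC; apply: ler_wpM2l; lra.
Qed.

(** Here the windows of [window_large] are enough. They start at [t = n - 2], the first value
    allowed by [window_step], which makes consecutive ones overlap. *)
Lemma window_n4 (n : nat) u v L : (4 <= n)%N -> 0 < L ->
  let x : R := n%:R - 1 in
  (1 + x ^+ 5) * L <= u -> x ^+ 3 * (u - L) <= v - L ->
  window n u v L.
Proof.
move=> n4 L0 x uL vu.
have x3 : 3 <= x by have : 4 <= n%:R :> R; [rewrite ler_nat | rewrite /x; lra].
have NE : n%:R = x + 1 :> R by rewrite /x subrK.
pose c : R := (8 * x - 7) * (8 * x + 9).
pose Q (t : nat) := c * t%:R * L + ((8 * x + 9) * t%:R - 1) * u + (x - 1) * L <= x * v.
have pw j : 0 < x ^+ j by apply: exprn_gt0; lra.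
have u0 : 0 < u by apply: lt_le_trans uL; apply: mulr_gt0 => //; have := pw 5%N; lra.
have x5L : x ^+ 5 * L <= u by lra.
have x2 : 9 <= x ^+ 2 by rewrite expr2; nra.
have x2x : 3 * x <= x ^+ 2 by rewrite expr2; apply: ler_wpM2r; lra.
have x3x : 3 * x ^+ 2 <= x ^+ 3 by rewrite [x ^+ 3]exprS; apply: ler_wpM2r; lra.
have x4x : 3 * x ^+ 3 <= x ^+ 4 by rewrite [x ^+ 4]exprS; apply: ler_wpM2r; lra.
have x5x : 3 * x ^+ 4 <= x ^+ 5 by rewrite [x ^+ 5]exprS; apply: ler_wpM2r; lra.
have x4' : 9 * x ^+ 2 <= x ^+ 4 by lra.
have v_ge : x ^+ 4 * (u - L) + x * L <= x * v.
  by have := ler_wpM2l (ltW (pw 1%N)) vu; rewrite expr1 mulrA -exprS; lra.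
have cE : c = 64 * x ^+ 2 + 16 * x - 63 by rewrite /c; ring.
have c_ge0 : 0 <= c by rewrite /c; apply: mulr_ge0; lra.
have n2 : (2 <= n)%N by apply: leq_trans n4.
have tE : ((n - 2)%:R : R) = x - 1 by rewrite (natrB _ n2) NE; ring.
have Q0 : Q (n - 2)%N.
  rewrite /Q tE cE.
  (* The coefficient equals 16 at [x = 3], that is for [n = 4]. *)
  have a1 : 16 * u <= (x ^+ 4 - 8 * x ^+ 2 - x + 10) * u.
    by apply: ler_wpM2r; [lra | lra].
  have a2 : (x ^+ 4 + 64 * x ^+ 3) * L <= (16 * x ^+ 5) * L.
    by apply: ler_wpM2r; lra.
  have a3 : 0 <= (48 * x ^+ 2 + 79 * x - 63) * L by apply: mulr_ge0; lra.
  have e1 : (64 * x ^+ 2 + 16 * x - 63) * (x - 1) =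
     64 * x ^+ 3 - 48 * x ^+ 2 - 79 * x + 63 by ring.
  have e2 : (8 * x + 9) * (x - 1) - 1 = 8 * x ^+ 2 + x - 10 by ring.
  have a4 : 0 <= x * L by apply: mulr_ge0; lra.
  rewrite e1 e2.
  have -> : (64 * x ^+ 3 - 48 * x ^+ 2 - 79 * x + 63) * L =
     64 * x ^+ 3 * L - (48 * x ^+ 2 + 79 * x - 63) * L by ring.
  by apply: le_trans v_ge; lra.
have v0 : 0 < v.
  have : 0 <= x ^+ 4 * (u - L) by apply: mulr_ge0; [apply: ltW | have := mulr_gt0 (pw 5%N) L0; lra].
  have : 0 < x * L by apply: mulr_gt0; lra.
  move=> h1 h2; have : 0 < x * v by lra.
  by rewrite pmulr_rgt0 //; lra.
have vu0 : 0 <= v / u by apply: divr_ge0; lra.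
have NQ : ~~ Q ((Num.truncn (v / u)).+1 + (n - 2))%N.
  have := truncn_itv vu0 => /andP[_]; rewrite ltr_pdivrMr // => h.
  rewrite /Q -ltNge natrD tE.
  move: (_.+1%:R : R) h (ler0n R (Num.truncn (v / u)).+1) => y h y0.
  have b1 : 0 <= c * (y + (x - 1)) * L.
    by apply: mulr_ge0; [apply: mulr_ge0; lra | lra].
  have b2 : x * v < x * (y * u) by rewrite ltr_pM2l //; lra.
  have b3 : 0 <= (x - 1) * L by apply: mulr_ge0; lra.
  have b4 : 0 <= y * u by apply: mulr_ge0; lra.
  have b5 : 0 <= (8 * x + 9) * (x - 1) * u - u.
    have : 8 * u <= (8 * x + 9) * (x - 1) * u by apply: ler_wpM2r; nra.
    lra.
  have b6 : 0 <= x * (y * u) by apply: mulr_ge0; lra.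
  lra.
have [t /andP[t2 _] /andP[Qt]] := last_true (leq_addl _ _) Q0 NQ.
rewrite /Q -ltNge -[t.+1%:R]natr1 => QS.
have Tx : x - 1 <= t%:R :> R by rewrite -tE ler_nat.
have t1 : (1 <= t)%N.
  by apply: leq_trans t2; rewrite subn_gt0 (leq_trans _ n4).
have nt : (n <= 14 * t + 3)%N.
  have : (n <= t + 2)%N by rewrite addnC -leq_subLR.
  by clear; lia.
apply: (window_large (ltnW n4) t1 nt); last first.
  move: Qt; rewrite /Q /c NE.
  have -> : 8 * (x + 1) - 15 = 8 * x - 7 by ring.
  have -> : 8 * (x + 1) + 1 = 8 * x + 9 by ring.
  have -> : x + 1 - 2 = x - 1 by ring.
  by have -> : x + 1 - 1 = x by ring.
rewrite NE -(ler_pM2l (_ : 0 < x)); last by lra.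
apply: le_trans (ltW QS) _.
exact: window_step.
Qed.

End Windows.

(** * Gap principle and count of the solutions near each root *)

Lemma fact_le_exp (n e : nat) : (e <= n)%N -> (e`! <= n ^ e)%N.
Proof.
elim: e => [|e IH] en; first by rewrite fact0 expn0.
by rewrite factS expnS leq_mul // IH // ltnW.
Qed.

Lemma size_le_fibers (T U : eqType) (g : T -> U) (b : nat) (s : seq U)
    (S : seq T) :
  (forall p, p \in S -> g p \in s) ->
  (forall a, a \in s -> (count (fun p => g p == a) S <= b)%N) ->
  (size S <= b * size s)%N.
Proof.
elim: s S => [|a s IH] S hS hc.
  by case: S hS {hc} => // p S /(_ p (mem_head _ _)).
rewrite -(count_predC (fun p => g p == a) S) /= mulnS leq_add //.
  by rewrite hc // mem_head.
rewrite -size_filter; apply: IH => [p|c sc].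
  rewrite mem_filter => /andP[/= pa /hS].
  by rewrite inE (negPf pa).
rewrite count_filter; apply: leq_trans (hc c _); last by rewrite inE sc orbT.
by apply: sub_count => p /andP[].
Qed.

Lemma coprime_frac_inj (p q : int * int) : gcdz p.1 p.2 = 1 ->
  gcdz q.1 q.2 = 1 -> 0 < p.2 -> 0 < q.2 -> p.1 * q.2 = q.1 * p.2 -> p = q.
Proof.
case: p q => [x y] [z w] /= cp cq y0 w0 E.
have yw : (y %| w)%Z.
  have cyx : coprimez y x by rewrite coprimez_sym /coprimez cp.
  by rewrite -(Gauss_dvdzr _ cyx) E dvdz_mull // dvdzz.
have wy : (w %| y)%Z.
  have cwz : coprimez w z by rewrite coprimez_sym /coprimez cq.
  by rewrite -(Gauss_dvdzr _ cwz) -E dvdz_mull // dvdzz.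
have yE : y = w.
  have := @gtz0_abs y y0; have := @gtz0_abs w w0.
  move: yw wy; rewrite !dvdzE => h1 h2.
  have : `|y|%N = `|w|%N by apply/eqP; rewrite eqn_dvd h1.
  by move=> -> -> .
by move: E; rewrite yE => /(mulIf (_ : w != 0)) -> //; rewrite gt_eqF.
Qed.

Section Chains.
Variable R : realType.
Notation C := R[i].
Notation nc := (@ComplexField.Normc.normc R).
Notation pZ := (map_poly (intr : int -> C)).
Variables (f : {poly int}) (n : nat) (s : n.-tuple C).
Hypothesis n3 : (3 <= n)%N.
Hypothesis f0 : f != 0.
Hypothesis fE : pZ f = (lead_coef f)%:~R *: \prod_(a <- s) ('X - a%:P).
Hypothesis f_irr : irreducible_poly (map_poly (intr : int -> rat) f).
Hypothesis us : uniq s.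

Let M := poly_mahler f s.
Let N : R := n%:R.

Variables (L : R) (m : nat).
Hypothesis m0 : (0 < m)%N.
Hypothesis hL :
  (N - 2) * L = N * ln 2 + (N - 2^-1) * ln N + ln m%:R + (N - 2) * ln M.

Let lm0 : 0 <= ln (m%:R : R).
Proof. by rewrite ln_ge0 // ler1n. Qed.

Let N3 : 3 <= N.
Proof. by rewrite /N ler_nat. Qed.

Lemma L_gt0 : 0 < L.
Proof.
have h1 : ln M + ln 2 + ln 3 <= L := L_ge n3 lm0 hL.
have h2 : 0 <= ln M := lnM_ge0 s f0.
by have := @ln2_gt0 R; have := @ln2_lt_ln3 R; lra.
Qed.

(** With [b = expR L], the last two clauses say that [y > b ^ (1 + 1 / (n - 1))] and that [x / y] is
    within [b ^ (n - 2) / (2 y ^ n)] of [a]. *)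
Definition approximates (a : C) (p : int * int) : Prop :=
  [/\ 0 < p.2, gcdz p.1 p.2 = 1, (1 + 1 / (N - 1)) * L < ln p.2%:~R &
      nc (p.1%:~R / p.2%:~R - a) <=
        expR ((N - 2) * L - ln 2 - N * ln p.2%:~R)].

(** The Lewis-Mahler constant fits into [expR ((N - 2) * L) / 2], because [(n - 1)! <= n ^ (n - 1)
    <= n ^ (n - 1 / 2)] and [2 ^ (n - 1)] is half of [2 ^ n]. *)
Lemma solution_approximates (x y : int) : 0 < y ->
  nc (pZ f).[x%:~R / y%:~R] * y%:~R ^+ n <= m%:R ->
  exists2 a, a \in tval s & nc (x%:~R / y%:~R - a) <=
    expR ((N - 2) * L - ln 2 - N * ln y%:~R).
Proof.
have N_ge := N3; move=> y0 hF; have [a sa ha] := lewis_mahler (ltnW n3) f0 fE us (x%:~R / y%:~R).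
exists a => //; apply: le_trans ha _; rewrite -/M.
have M1 : 1 <= M := poly_mahler_ge1 s f0.
have M0 : 0 < M by apply: lt_le_trans M1.
have yr : 0 < (y%:~R : R) by rewrite ltr0z.
have yn : 0 < (y%:~R : R) ^+ n by apply: exprn_gt0.
have n0 : (0 < n)%N by apply: leq_trans n3.
have Nr : 0 < N by rewrite /N ltr0n.
have eN : expR (N * ln y%:~R) = y%:~R ^+ n :> R by rewrite expRM_natl lnK.
have e2 : expR (N * ln 2 - ln 2) = 2 ^+ n.-1 :> R.
  have -> : N * ln 2 - ln 2 = (n.-1)%:R * ln 2.
    by rewrite -subn1 (natrB _ n0) -/N; ring.
  by rewrite expRM_natl lnK // posrE.
have eM : expR ((N - 2) * ln M) = M ^+ n.-2.
  by rewrite /N -(natrB _ (ltnW n3)) subn2 expRM_natl lnK.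
have em : expR (ln m%:R) = m%:R :> R by rewrite lnK // posrE ltr0n.
have ef : ((n.-1)`!%:R : R) <= expR ((N - 2^-1) * ln N).
  have lN : 0 <= ln N by apply: ln_ge0; lra.
  apply: (@le_trans _ _ (expR ((N - 1) * ln N))).
    rewrite /N -(natrB _ n0) subn1 expRM_natl lnK ?posrE // -natrX ler_nat.
    by rewrite fact_le_exp // leq_pred.
  by rewrite ler_expR; apply: ler_wpM2r => //; lra.
have hf : nc (pZ f).[x%:~R / y%:~R] <= m%:R / y%:~R ^+ n by rewrite ler_pdivlMr.
have -> : expR ((N - 2) * L - ln 2 - N * ln y%:~R) =
    2 ^+ n.-1 * expR ((N - 2^-1) * ln N) * M ^+ n.-2 * (m%:R / y%:~R ^+ n).
  rewrite -e2 -eM -em -eN -expRN -!expRD; congr expR; rewrite hL; ring.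
apply: ler_pM => //; last 1 first.
- apply: ler_wpM2r; first by apply: exprn_ge0; apply: ltW.
  by apply: ler_wpM2l => //; apply: exprn_ge0.
- apply: mulr_ge0; last by apply: exprn_ge0; apply: ltW.
  by apply: mulr_ge0 => //; apply: exprn_ge0.
- exact: normc_ge0.
Qed.

(** Two distinct fractions differ by at least the inverse product of their denominators, while each
    is within half of [expR E] of [a]. Measuring from [L] turns the resulting affine recursion into
    multiplication by [N - 1]. *)
Lemma gap_principle (a : C) (p q : int * int) : approximates a p ->
  approximates a q -> p != q -> p.2 <= q.2 ->
  (N - 1) * (ln p.2%:~R - L) <= ln q.2%:~R - L.
Proof.
have N_ge := N3; move=> [p0 cp _ hp] [q0 cq _ hq] pq le_pq.
have pr : 0 < (p.2%:~R : R) by rewrite ltr0z.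
have qr : 0 < (q.2%:~R : R) by rewrite ltr0z.
have pc : (p.2%:~R : C) != 0 by rewrite intr_eq0 gt_eqF.
have qc : (q.2%:~R : C) != 0 by rewrite intr_eq0 gt_eqF.
set u := ln p.2%:~R in hp *; set v := ln q.2%:~R in hq *.
have uv : u <= v by rewrite /u /v ler_ln ?posrE // ler_int.
have eu : expR u = p.2%:~R by rewrite lnK.
have ev : expR v = q.2%:~R by rewrite lnK.
pose z := p.1 * q.2 - q.1 * p.2.
have z0 : z != 0.
  by rewrite subr_eq0; apply: contra pq => /eqP E; apply/eqP/coprime_frac_inj.
have zE : z%:~R = p.2%:~R * q.2%:~R *
    ((p.1%:~R / p.2%:~R - a) - (q.1%:~R / q.2%:~R - a)) :> C.
  by rewrite /z rmorphB !rmorphM /=; field; rewrite pc qc.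
have z1 : 1 <= nc (z%:~R : C).
  by rewrite normc_int -intr_norm ler1z -gtz0_ge1 normr_gt0.
pose E := (N - 2) * L - N * u.
have key : 1 <= expR (u + v + E).
  apply: le_trans z1 _; rewrite zE !normc_M !normc_int !gtr0_norm // (expRD (u + v)) (expRD u) eu ev.
  apply: ler_wpM2l; first by apply: mulr_ge0; apply: ltW.
  apply: le_trans (normc_B _ _) _.
  have -> : expR E = expR (E - ln 2) + expR (E - ln 2).
    by rewrite (expRD E) expRN lnK ?posrE //; field.
  apply: lerD; [apply: le_trans hp _ | apply: le_trans hq _]; rewrite ler_expR /E.
    lra.
  by have : N * u <= N * v; [apply: ler_wpM2l; lra | lra].
by move: key; rewrite -[X in X <= _]expR0 ler_expR /E; lra.
Qed.

Lemma no_long_chain (a : C) (l : seq (int * int)) : a \in tval s ->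
  uniq l -> sorted (fun p q : int * int => p.2 <= q.2) l ->
  (forall p, p \in l -> approximates a p) ->
  (size l <= (if n == 3 then 11 else 9))%N.
Proof.
have N_ge := N3; move=> sa ul sl hl; rewrite leqNgt; apply/negP => hsize.
pose x0 : int * int := (0, 0).
pose p i := nth x0 l i; pose w i := ln (p i).2%:~R - L.
have hp i : (i < size l)%N -> approximates a (p i).
  by move=> il; apply/hl/mem_nth.
have L0 := L_gt0.
have step i : (i.+1 < size l)%N -> (N - 1) * w i <= w i.+1.
  move=> il; apply: (gap_principle (hp _ (ltnW il)) (hp _ il)).
    by rewrite nth_uniq // ?ltn_eqF // ltnW.
  exact: (sortedP x0 sl).
have steps i j : (i + j < size l)%N -> (N - 1) ^+ j * w i <= w (i + j)%N.
  elim: j => [|j IH] ij; first by rewrite expr0 mul1r addn0.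
  rewrite addnS in ij *; apply: le_trans (step _ ij).
  by rewrite exprS -mulrA; apply: ler_wpM2l; [lra | apply: IH; apply: ltnW].
(* The exponent is one less than the index because the chain starts from [w 0 >= L / (N - 1)]. *)
have start j : (j.+1 < size l)%N -> (N - 1) ^+ j * L <= w j.+1.
  move=> jl; apply: le_trans (steps 0%N j.+1 jl).
  rewrite exprSr -mulrA; apply: ler_wpM2l; first by apply: exprn_ge0; lra.
  have [_ _ h _] := hp 0%N (leq_trans (ltn0Sn _) jl).
  have : L / (N - 1) <= w 0%N by rewrite /w; lra.
  by rewrite ler_pdivrMr 1?mulrC //; lra.
have contra i j : (i < size l)%N -> (j < size l)%N -> L <= w i + L ->
    window n (w i + L) (w j + L) L -> False.
  move=> il jl Lw [k [d [e [J [c [hd hJ e0 k0 [[Jk d3 dk] [cE hI hII]]]]]]]].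
  have [pi0 _ _ hi] := hp _ il; have [pj0 _ _ hj] := hp _ jl.
  have wE i' : w i' + L = ln (p i').2%:~R by rewrite /w subrK.
  rewrite -wE in hi; rewrite -wE in hj.
  exact: (thue_contradiction n3 f0 fE f_irr us lm0 hL pi0 pj0 sa (wE i) (wE j)
    hi hj Lw hd hJ e0 k0 Jk d3 dk cE hI hII).
case: eqP hsize => [nE|/eqP nN] hsize.
(* Twelve solutions give [w 9 >= 2 ^ 8 * L] and [w 11 >= 2 ^ 2 * w 9], whence the constants 257 and
   4 of [window_n3]. *)
- have NE : N = 3 by rewrite /N nE.
  have i9 : (9 < size l)%N by apply: leq_trans hsize.
  have h9 := start 8%N i9; have h11 := steps 9%N 2%N hsize.
  have E8 : (N - 1) ^+ 8 = 256 by rewrite NE; ring.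
  have E2 : (N - 1) ^+ 2 = 4 by rewrite NE; ring.
  rewrite E8 in h9; rewrite E2 in h11.
  apply: (contra 9%N 11%N) => //; first by lra.
  by rewrite nE; apply: window_n3 => //; rewrite ?addrK; lra.
(* Ten solutions give the fifth power of [N - 1] at index 6 and three further gaps up to index 9, as
   [window_n4] asks. *)
have n4 : (4 <= n)%N by rewrite ltn_neqAle eq_sym nN.
have i6 : (6 < size l)%N by apply: leq_trans hsize.
have h6 := start 5%N i6; have h9 := steps 6%N 3%N hsize.
have p5 : 0 <= (N - 1) ^+ 5 * L.
  by apply: mulr_ge0; [apply: exprn_ge0; lra | lra].
apply: (contra 6%N 9%N) => //; first by lra.
by apply: window_n4 => //; rewrite -/N; rewrite ?addrK; lra.
Qed.

Lemma solutions_bound (S : seq (int * int)) : uniq S ->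
  (forall p, p \in S -> [/\ 0 < p.2, gcdz p.1 p.2 = 1,
     (1 + 1 / (N - 1)) * L < ln p.2%:~R &
     nc (pZ f).[p.1%:~R / p.2%:~R] * p.2%:~R ^+ n <= m%:R]) ->
  (size S <= (if n == 3 then 11 else 9) * n)%N.
Proof.
move=> uS hS.
have /choice[g hg] (p : int * int) : exists a : C, p \in S ->
    a \in tval s /\ approximates a p.
  have [pS|] := boolP (p \in S); last by exists 0.
  have [p0 cp hY hF] := hS _ pS.
  by have [a sa ha] := solution_approximates p0 hF; exists a.
rewrite -{2}(size_tuple s); apply: (@size_le_fibers _ _ g) => [p /hg[]//|a sa].
pose l := [seq p <- S | g p == a].
pose r (p q : int * int) := p.2 <= q.2.
have rt : total r by move=> p q; apply: le_total.
rewrite -size_filter -/l -(size_sort r l); apply: (no_long_chain sa).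
- by rewrite sort_uniq filter_uniq.
- exact: sort_sorted.
- move=> p; rewrite mem_sort mem_filter => /andP[/eqP<- /hg[]] //.
Qed.

End Chains.

(** The bound on lists also yields finiteness: an infinite set would contain a finite subset with
    more than [b] elements. *)
Lemma card_le_of_uniq_seq (T : choiceType) (S : set T) (b : nat) :
  (forall l : seq T, uniq l -> (forall p, p \in l -> S p) -> (size l <= b)%N) ->
  (S #<= `I_b)%card.
Proof.
move=> h.
have fS : finite_set S.
  apply: contrapT => /(infinite_set_fset b.+1)[B BS].
  by rewrite ltnNge h ?finmap.fset_uniq // => p /BS.
have /finite_setP[k Sk] := fS.
rewrite (card_le_eql Sk) card_le_II -(card_fset_set Sk).
by apply: h => [|p]; rewrite ?finmap.fset_uniq ?in_fset_set ?inE.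
Qed.

(** * Dehomogenization of binary forms and transfer of irreducibility *)

Section Forms.
Let i0 : 'I_2 := ord0.
Let i1 : 'I_2 := lift ord0 ord0.

Lemma form_valE (A : comNzRingType) (F : {mpoly int[2]}) (x y : A) :
  form_val F x y =
  \sum_(m <- msupp F) (F@_m)%:~R * (x ^+ m i0 * y ^+ m i1).
Proof.
rewrite /form_val /mmap; apply: eq_bigr => m _; congr (_ * _).
by rewrite /mmap1 !big_ord_recl big_ord0 mulr1.
Qed.

Lemma rmorph_form_val (A B : comNzRingType) (phi : {rmorphism A -> B})
    (F : {mpoly int[2]}) (x y : A) :
  phi (form_val F x y) = form_val F (phi x) (phi y).
Proof.
rewrite !form_valE rmorph_sum; apply: eq_bigr => m _.
by rewrite !rmorphM !rmorphXn /= rmorph_int.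
Qed.

Section Homogeneous.
Variables (n : nat) (F : {mpoly int[2]}).
Hypothesis F_homog : F \is n.-homog.

Lemma supp_deg m : m \in msupp F -> (m i0 + m i1 = n)%N.
Proof.
move=> /(dhomog_mf F_homog) mE; have : mdeg m = n := mE.
by rewrite mdegE !big_ord_recl big_ord0 addn0.
Qed.

Lemma form_val_scale (A : comNzRingType) (c x y : A) :
  form_val F (c * x) (c * y) = c ^+ n * form_val F x y.
Proof.
rewrite !form_valE mulr_sumr; apply: eq_big_seq => m /supp_deg <-.
by rewrite !exprMn exprD; ring.
Qed.

Definition dehom : {poly int} := form_val F 'X 1.

Lemma dehom_int (A : comNzRingType) (phi : {rmorphism int -> A}) :
  map_poly phi dehom = \sum_(m <- msupp F) (F@_m)%:~R *: 'X^(m i0).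
Proof.
rewrite /dehom (rmorph_form_val (map_poly phi)) /= map_polyX rmorph1 form_valE.
by apply: eq_bigr => m _; rewrite expr1n mulr1 mulrzl scaler_int.
Qed.

Lemma dehom_horner (A : comNzRingType) (phi : {rmorphism int -> A}) (t : A) :
  (map_poly phi dehom).[t] = form_val F t 1.
Proof.
rewrite dehom_int form_valE horner_sum; apply: eq_bigr => m _.
by rewrite hornerZ hornerXn expr1n mulr1.
Qed.

Lemma coef_dehom (A : comNzRingType) (phi : {rmorphism int -> A}) i :
  (map_poly phi dehom)`_i = \sum_(m <- msupp F) (F@_m)%:~R * (i == m i0)%:R.
Proof.
rewrite dehom_int coef_sum; apply: eq_bigr => m _.
by rewrite coefZ coefXn.
Qed.

Lemma size_dehom_le : (size dehom <= n.+1)%N.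
Proof.
apply/leq_sizeP => i ni.
have -> : dehom = map_poly idfun dehom by rewrite map_poly_id.
rewrite coef_dehom big_seq big1 // => m /supp_deg mE.
by rewrite gtn_eqF ?mulr0 // (leq_trans _ ni) // ltnS -mE leq_addr.
Qed.

Lemma coef_dehom_lead : dehom`_n = form_lead F.
Proof.
have -> : dehom = map_poly idfun dehom by rewrite map_poly_id.
rewrite coef_dehom /form_lead form_valE; apply: eq_big_seq => m /supp_deg mE.
by rewrite expr1n mul1r -mE -[X in _ == X]addn0 eqn_add2l expr0n.
Qed.

(** The form [y ^ d g(x / y)]. The degree [d] is free: when it exceeds that of [g], a power of [y]
    factors out. *)
Definition homogenize (d : nat) (g : {poly rat}) : {mpoly rat[2]} :=
  \sum_(i < d.+1) g`_i *: ('X_i0 ^+ i * 'X_i1 ^+ (d - i)).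

Lemma homogenizeD d : {morph homogenize d : g h / g + h}.
Proof.
move=> g h; rewrite /homogenize -big_split; apply: eq_bigr => i _ /=.
by rewrite coefD scalerDl.
Qed.

Lemma homogenize0 d : homogenize d 0 = 0.
Proof. by rewrite /homogenize big1 // => i _; rewrite coef0 scale0r. Qed.

Lemma homogenizeZ d c g : homogenize d (c *: g) = c *: homogenize d g.
Proof.
rewrite /homogenize scaler_sumr; apply: eq_bigr => i _.
by rewrite coefZ scalerA.
Qed.

Lemma homogenize_sum d (I : Type) (r : seq I) (P : pred I) (G : I -> {poly rat}) :
  homogenize d (\sum_(i <- r | P i) G i) = \sum_(i <- r | P i) homogenize d (G i).
Proof. exact: (big_morph _ (@homogenizeD d) (homogenize0 d)). Qed.

Lemma homogenizeXn d i : (i <= d)%N ->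
  homogenize d 'X^i = 'X_i0 ^+ i * 'X_i1 ^+ (d - i).
Proof.
move=> id; have id' : (i < d.+1)%N by [].
rewrite /homogenize (bigD1 (Ordinal id')) //= coefXn eqxx scale1r.
rewrite big1 ?addr0 // => j ji; rewrite coefXn -val_eqE /= in ji *.
by rewrite (negPf ji) scale0r.
Qed.

Lemma homogenizeM d e (g h : {poly rat}) : (size g <= d.+1)%N ->
  (size h <= e.+1)%N ->
  homogenize (d + e) (g * h) = homogenize d g * homogenize e h.
Proof.
move=> sg sh.
have polyE b (p : {poly rat}) : (size p <= b.+1)%N ->
    p = \sum_(i < b.+1) p`_i *: 'X^i.
  by move=> sp; rewrite -poly_def; apply/polyP => i; rewrite coef_poly;
    case: ltnP => // /(leq_trans sp) hi; rewrite nth_default.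
rewrite {1}(polyE _ _ sg) {1}(polyE _ _ sh) mulr_suml homogenize_sum.
rewrite [X in _ = X * _]/homogenize mulr_suml; apply: eq_bigr => i _.
rewrite mulr_sumr homogenize_sum mulr_sumr; apply: eq_bigr => j _.
have id : (i <= d)%N by rewrite -ltnS.
have je : (j <= e)%N by rewrite -ltnS.
rewrite -scalerAl -scalerAr scalerA -exprD homogenizeZ homogenizeXn ?leq_add //.
rewrite -scalerAl -scalerAr scalerA; congr (_ *: _).
have -> : (d + e - (i + j) = (d - i) + (e - j))%N by lia.
by rewrite !exprD; ring.
Qed.

Lemma homogenize_dehom :
  map_mpoly (intr : int -> rat) F = homogenize n (map_poly intr dehom).
Proof.
rewrite dehom_int homogenize_sum /map_mpoly /mmap; apply: eq_big_seq => m mF.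
have mE := supp_deg mF.
rewrite homogenizeZ homogenizeXn; last by rewrite -mE leq_addr.
rewrite /= mul_mpolyC /mmap1 !big_ord_recl big_ord0 mulr1; congr (_ *: (_ * _ ^+ _)).
by rewrite -mE addKn.
Qed.

(** A form of positive degree vanishes at the origin, whereas evaluation there sends units to
    units. *)
Lemma homogenize_unit d g : homogenize d g \is a GRing.unit -> d = 0%N.
Proof.
move=> /(rmorph_unit (meval (fun _ => 0))); case: d => // d.
rewrite unitfE rmorph_sum big1 ?eqxx // => i _ /=.
rewrite mevalZ mevalM !rmorphXn /= !mevalXU; case: i => -[|i] hi /=.
  by rewrite subn0 [0 ^+ d.+1]exprS mul0r !mulr0.
by rewrite [0 ^+ i.+1]exprS !mul0r mulr0.
Qed.

Hypothesis n2 : (2 <= n)%N.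
Hypothesis F_irr : irreducible_form F.

Lemma form_lead_neq0 : form_lead F != 0.
Proof.
apply/eqP => l0; have [_ irr] := F_irr.
pose g : {poly rat} := map_poly intr dehom.
have sg : (size g <= n.-1.+1)%N.
  rewrite prednK; last exact: ltnW.
  apply/leq_sizeP => i; rewrite leq_eqVlt => /predU1P[<-|ni].
    by rewrite coef_map coef_dehom_lead l0.
  by rewrite coef_map nth_default // (leq_trans size_dehom_le).
(* [homogenize 1 1] is the variable [y]: without a leading term, [F] would be divisible by it. *)
have E : map_mpoly (intr : int -> rat) F = homogenize 1 1 * homogenize n.-1 g.
  rewrite homogenize_dehom -homogenizeM ?size_poly1 // mul1r add1n prednK //.
  exact: ltnW.
by case: (irr _ _ E) => /homogenize_unit //; case: (n) n2 => [|[]].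
Qed.

Lemma size_dehom : size dehom = n.+1.
Proof.
apply/eqP; rewrite eqn_leq size_dehom_le /= ltnNge; apply/negP => sn.
have := form_lead_neq0; rewrite -coef_dehom_lead nth_default ?eqxx //.
Qed.

Lemma dehom_neq0 : dehom != 0.
Proof. by rewrite -size_poly_gt0 size_dehom. Qed.

Lemma lead_coef_dehom : lead_coef dehom = form_lead F.
Proof. by rewrite lead_coefE size_dehom coef_dehom_lead. Qed.

(** A factorization of the polynomial homogenizes to one of [F], with degrees adding up to [n]; a
    unit factor of [F] has degree 0 and so comes from a constant. *)
Lemma dehom_irreducible : irreducible_poly (map_poly (intr : int -> rat) dehom).
Proof.
set g := map_poly _ _.
have sg : size g = n.+1.
  by rewrite size_map_poly_id0 ?size_dehom // intr_eq0 lead_coef_eq0 dehom_neq0.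
have g0 : g != 0 by rewrite -size_poly_gt0 sg.
split; first by rewrite sg ltnS ltnW.
move=> q sq /dvdpP[r gE]; have [_ irr] := F_irr.
have q0 : q != 0 by apply: contraNneq g0 => q0; rewrite gE q0 mulr0.
have r0 : r != 0 by apply: contraNneq g0 => r0; rewrite gE r0 mul0r.
have q1 : (0 < size q)%N by rewrite size_poly_gt0.
have r1 : (0 < size r)%N by rewrite size_poly_gt0.
have nE : n = ((size r).-1 + (size q).-1)%N.
  have := sg; rewrite gE size_mul //.
  by move: q1 r1; case: (size q) (size r) => [|a] [|b] //= _ _; rewrite addnS => -[].
have E : map_mpoly (intr : int -> rat) F =
    homogenize (size r).-1 r * homogenize (size q).-1 q.
  by rewrite homogenize_dehom -/g {1}nE gE homogenizeM ?leqSpred.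
case: (irr _ _ E) => /homogenize_unit h0; last first.
  by case/eqP: sq; rewrite -(prednK q1) h0.
have rC : (size r <= 1)%N by rewrite -(prednK r1) h0.
rewrite gE (size1_polyC rC) mul_polyC eqp_sym eqp_scale //.
by apply: contraNneq r0 => r00; rewrite (size1_polyC rC) r00.
Qed.

End Homogeneous.
End Forms.

(** * From the form to its dehomogenized polynomial and back *)

Section FormSolutions.
Variables (R : realType) (n : nat) (F : {mpoly int[2]}) (m : nat).
Notation C := R[i].
Notation nc := (@ComplexField.Normc.normc R).
Notation pZ := (map_poly (intr : int -> C)).
Hypotheses (n3 : (3 <= n)%N) (F_homog : F \is n.-homog).
Hypotheses (F_irr : irreducible_form F) (F_disc : form_disc R n F != 0).
Hypothesis m_gt0 : (0 < m)%N.

Let N : R := n%:R.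
Let s := form_roots R F.

Lemma form_roots_uniq : uniq s.
Proof.
apply: contraNT F_disc => /(uniqPn 0)[i [j [ij js sij]]].
rewrite /form_disc -/s mulf_eq0; apply/orP; right.
apply/eqP; rewrite (bigD1 (Ordinal js)) //= (bigD1 (Ordinal ij)) //=.
by rewrite sij subrr expr0n /= !mul0r.
Qed.

Lemma dehom_roots :
  pZ (dehom F) = (lead_coef (dehom F))%:~R *: \prod_(a <- s) ('X - a%:P).
Proof.
have E : pZ (dehom F) = form_val F 'X 1.
  by rewrite /dehom (rmorph_form_val (map_poly intr)) /= map_polyX rmorph1.
rewrite -lead_coef_map_inj //; last exact: intr_inj.
by rewrite E /s /form_roots; case: closed_field_poly_normal.
Qed.

Lemma size_form_roots : size s == n.
Proof.
have n2 := ltnW n3.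
have := congr1 (fun p : {poly C} => size p) dehom_roots.
rewrite size_scale; last by rewrite intr_eq0 lead_coef_eq0 (dehom_neq0 F_homog n2 F_irr).
by rewrite size_prod_XsubC size_pZ (size_dehom F_homog n2 F_irr) => -[->].
Qed.

Lemma form_val_horner (x y : int) : y != 0 ->
  (pZ (dehom F)).[x%:~R / y%:~R] * y%:~R ^+ n = (form_val F x y)%:~R.
Proof.
move=> y0; have y0' : (y%:~R : C) != 0 by rewrite intr_eq0.
rewrite dehom_horner mulrC -(form_val_scale F_homog) mulrC divfK // mulr1.
by rewrite (rmorph_form_val (intr : int -> C)).
Qed.

Lemma solutions_size (l : seq (int * int)) : uniq l ->
  (forall p, p \in l -> primitive_solution F m p.1 p.2 /\
    (2 `^ (N / (N - 2)) * N `^ ((2 * N - 1) / (2 * N - 4)) *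
     m%:R `^ (1 / (N - 2)) * mahler R F) `^ (1 + 1 / (N - 1)) < p.2%:~R) ->
  (size l <= (if n == 3 then 11 else 9) * n)%N.
Proof.
set B := _ * mahler R F => ul hl.
have n2 := ltnW n3.
have f0 := dehom_neq0 F_homog n2 F_irr.
have f_irr := dehom_irreducible F_homog n2 F_irr.
pose t : n.-tuple C := Tuple size_form_roots.
have ME : mahler R F = poly_mahler (dehom F) t.
  by rewrite /mahler /poly_mahler (lead_coef_dehom F_homog n2 F_irr).
have M1 : 1 <= mahler R F by rewrite ME poly_mahler_ge1.
have M0 : 0 < mahler R F by apply: lt_le_trans M1.
have N3 : 3 <= N by rewrite /N ler_nat.
have c0 : 0 < 2 `^ (N / (N - 2)) :> R by apply: powR_gt0.
have c1 : 0 < N `^ ((2 * N - 1) / (2 * N - 4)) by apply: powR_gt0; lra.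
have c2 : 0 < m%:R `^ (1 / (N - 2)) :> R by apply: powR_gt0; rewrite ltr0n.
have c01 := mulr_gt0 c0 c1; have c012 := mulr_gt0 c01 c2.
have B0 : 0 < B by apply: mulr_gt0.
(* Multiplying by [N - 2] clears the exponents; in particular [(2 N - 1) / (2 N - 4)] becomes
   [N - 1 / 2]. *)
have hL : (N - 2) * ln B = N * ln 2 + (N - 2^-1) * ln N + ln m%:R +
    (N - 2) * ln (poly_mahler (dehom F) t).
  rewrite -ME /B; move: (mahler R F) M0 => X X0.
  rewrite !lnM ?posrE // !ln_powR; field.
  by apply/andP; split; apply: lt0r_neq0; lra.
apply: (@solutions_bound R (dehom F) n t n3 f0 dehom_roots f_irr
  form_roots_uniq (ln B) m m_gt0 hL l ul).
move=> p /hl[[cp hF] hY].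
have Y0 : 0 < B `^ (1 + 1 / (N - 1)) by apply: powR_gt0.
have p0 : 0 < p.2 by rewrite -(ltr0z R); apply: lt_trans hY.
split => //.
  by rewrite -ln_powR ltr_ln ?posrE // (lt_trans Y0).
have -> : p.2%:~R ^+ n = nc (p.2%:~R ^+ n).
  by rewrite normc_X normc_int gtr0_norm // ltr0z.
rewrite -normc_M form_val_horner ?gt_eqF // normc_int -intr_norm.
by rewrite -[m%:R]/(m%:Z%:~R) ler_int.
Qed.

End FormSolutions.

Local Open Scope classical_set_scope.
Local Open Scope card_scope.
Local Open Scope ring_scope.

Theorem theorem1p7 (R : realType) (n : nat) (F : {mpoly int[2]}) (m : nat)
    (n_ge3 : (3 <= n)%N) (F_homog : F \is n.-homog)
    (F_irr : irreducible_form F) (F_disc : form_disc R n F != 0)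
    (m_gt0 : (0 < m)%N) :
  let N : R := n%:R in
  let Y : R :=
    (2 `^ (N / (N - 2)) * N `^ ((2 * N - 1) / (2 * N - 4)) *
     m%:R `^ (1 / (N - 2)) * mahler R F) `^ (1 + 1 / (N - 1)) in
  let S : set (int * int) :=
    [set p | primitive_solution F m p.1 p.2 /\ Y < p.2%:~R] in
  (S #<= `I_(11 * n)%N) /\ ((5 <= n)%N -> S #<= `I_(9 * n)%N).
Proof.
(* The count is [11 n] for [n = 3] and [9 n] for every larger [n]; the first claim weakens the
   latter. *)
move=> N Y S; split => [|n5]; apply: card_le_of_uniq_seq => l ul hl.
  apply: leq_trans (solutions_size n_ge3 F_homog F_irr F_disc m_gt0 ul hl) _.
  by rewrite leq_mul2r; case: (n == 3); rewrite orbT.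
have := solutions_size n_ge3 F_homog F_irr F_disc m_gt0 ul hl.
by rewrite gtn_eqF // (leq_trans _ n5).
Qed.
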